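(* Given an arbitrary nonempty subset $E$ of $\mathbb{R}^n$, a linear subspace $X\subset\mathbb{R}^n$, the orthogonal projection $P:=P_{X}:\mathbb{R}^n\to X$, and two functions $f:E \to \mathbb{R}$, $G: E \to \mathbb{R}^n$, the following is true. There exists a convex function $F:\mathbb{R}^n\to\mathbb{R}$ of class $C^{1,1}_{\mathrm{loc}}$ such that $F_{|_E}=f$, $(\nabla F)_{|_E} =G$, and $X_{F}=X$, if and only if the following conditions are satisfied. (i) $Y:=\mathrm{span}\left(\{G(y)-G(z) : y, z\in E\}\right)\subseteq X$. (ii) If $\ell:=\dim Y< d:= \dim X$, then there exist points $p_1, \ldots, p_{d-\ell} \in \mathbb{R}^n \setminus E$, numbers $\beta_1,\ldots, \beta_{d-\ell} \in \mathbb{R}$, vectors $w_1, \ldots, w_{d-\ell} \in \mathbb{R}^n$, and a sequence of numbers $A_k\geq 2$, $k\in\mathbb{N}$, such that, denoting $E^{*}:=E\cup\{p_1, \ldots, p_{d-\ell}\}$; $t_y:=f(y)$ and $\xi_y:=G(y)$ for $y\in E$; $t_y:=\beta_j$ and $\xi_y:=w_j$ for $y=p_j$, $j=1, \ldots, d-\ell$, we have that $$\mathrm{span}\{\xi_y-\xi_z : y, z\in E^{*}\}=X,$$ and $$t_z+\langle \xi_z, x-z\rangle \leq t_y+\langle \xi_y, x-y\rangle +\frac{A_k}{2}|P(x-y)|^2$$ for every $k\in\mathbb{N}$, every $z\in E^{*}$, every $y\in E^{*}\cap P^{-1}(B_X(0, k))$, and every $x\in P^{-1}(B_X(0, 4k))$.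 (iii) If $\ell=d$, then the preceding condition holds with $E$ in place of $E^{*}$ (no need to add new data). Furthermore, if $G$ is bounded then a formula for such an extension $F$ is given by $$F=\mathrm{conv}\left( x\mapsto \inf_{y\in E^{*}}\left\{t_y+\langle \xi_y, x-y\rangle +\tfrac{1}{2}\left( A_{k(y)} +4\|G\|_{\infty}+1\right) |P(x-y)|^2\right\}\right),$$ where $k(y)$ is defined as the first positive integer $k$ such that $y\in P^{-1}(B_X(0, k))$, and $\|G\|_{\infty}:=\sup_{x\in E}|G(x)|$.
   Context: $\mathbb{N}=\{1,2,3,\dots\}$. $|\cdot|$, $\langle\cdot,\cdot\rangle$ are the Euclidean norm and inner product. $B_X(0,r)$ is the closed ball of center $0$ and radius $r$ in the subspace $X$. When $\ell=d$, $E^*$ is read as $E$, with $t_y=f(y)$ and $\xi_y=G(y)$. $C^{1,1}_{\mathrm{loc}}$ is the class of differentiable functions whose gradient is locally Lipschitz (Lipschitz on every ball). $\mathrm{conv}(g)(x)=\sup\{\varphi(x) : \varphi \text{ convex}, \varphi\leq g\}$ is the convex envelope of $g:\mathbb{R}^n\to\mathbb{R}$. For a convex function $F:\mathbb{R}^n\to\mathbb{R}$, $X_F$ denotes the linear subspace $X_F=\mathrm{span}\{u-w : u\in\partial F(x), w\in\partial F(y), x,y\in\mathbb{R}^n\}$, where $\partial F$ is the subdifferential; for differentiable $F$, $X_F=\mathrm{span}\{\nabla F(x)-\nabla F(y): x,y\in\mathbb{R}^n\}$.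
   Formalization: When ℓ<d the stated formula fails for some data in (ii), as ‖G‖_∞ ignores the w_j; it is proved with the sup of |ξ_y| over E* in place of ‖G‖_∞, and with the original ‖G‖_∞ for some admissible sequence A'_k ≥ A_k. *)

(* Defs.v *)
From HB Require Import structures.
From mathcomp Require Import all_boot all_order all_algebra.
From mathcomp Require Import all_classical all_reals all_analysis.

Set Implicit Arguments.
Unset Strict Implicit.
Unset Printing Implicit Defensive.

Import Order.TTheory GRing.Theory Num.Theory.
Import numFieldNormedType.Exports.

Local Open Scope classical_set_scope.
Local Open Scope ring_scope.

Section Euclidean.
Context {R : realType} {n : nat}.
Local Notation V := 'rV[R]_n.
Implicit Types (F g : V -> R) (S : set V) (u v x y : V).

Definition dot u v : R := \sum_(i < n) u ord0 i * v ord0 i.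

(* The library norm on matrices is the max norm, hence this definition. *)
Definition enorm v : R := Num.sqrt (dot v v).

Definition is_orthoproj (X : {vspace V}) (P : V -> V) :=
  forall x, P x \in X /\ (forall v, v \in X -> dot (x - P x) v = 0).

Definition linspan S : set V :=
  [set v | exists (m : nat) (c : 'I_m -> R) (s : 'I_m -> V),
     (forall i, S (s i)) /\ v = \sum_(i < m) c i *: s i].

Definition vspan S : {vspace V} :=
  xget 0%VS [set W : {vspace V} | [set` W] = linspan S].

Lemma linspan_sub S (W : {vspace V}) : [set` W] `<=` linspan S ->
  forall a v, linspan S v -> forall w, w \in W -> linspan S (a *: v + w).
Proof.
move=> WS a v [m [c [s [Ss ->]]]] w /WS[m' [c' [s' [Ss' ->]]]].
exists (m + m')%N,
  (fun i => match fintype.split i with inl j => a * c j | inr j => c' j end),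
  (fun i => match fintype.split i with inl j => s j | inr j => s' j end).
split; first by move=> i; case: (fintype.split i).
rewrite big_split_ord scaler_sumr; congr (_ + _); apply: eq_bigr => i _.
  by rewrite -[lshift _ _]/(unsplit (inl _)) unsplitK scalerA.
by rewrite -[rshift _ _]/(unsplit (inr _)) unsplitK.
Qed.

Lemma vspanE S : [set` vspan S] = linspan S.
Proof.
rewrite /vspan; case: xgetP => // noW; exfalso.
pose Q k := `[< exists2 W : {vspace V}, [set` W] `<=` linspan S & \dim W = k >].
have Q0 : exists k, Q k.
  exists 0%N; apply/asboolP; exists 0%VS; last exact: dimv0.
  move=> v /=; rewrite memv0 => /eqP->.
  exists 0%N, (fun=> 0), (fun=> 0); split; first by case.
  by rewrite big_ord0.
have Qb k : Q k -> (k <= dim V)%N.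
  by move=> /asboolP[W _ <-]; rewrite -dimvf dimvS ?subvf.
case: (ex_maxnP Q0 Qb) => k /asboolP[W WS dW] kmax.
apply: (noW W); apply/seteqP; split => //= v Sv.
have WvS : [set` (<[v]> + W)%VS] `<=` linspan S.
  move=> u /= /memv_addP[_ /vlineP[a ->] [w Ww ->]].
  exact: (linspan_sub WS).
have /kmax : Q (\dim (<[v]> + W)) by apply/asboolP; exists (<[v]> + W)%VS.
rewrite -dW => /(conj (addvSr <[v]> W)) [sW dle].
have /eqP -> : (W == <[v]> + W)%VS by rewrite eqEdim sW.
by apply: (subvP (addvSl _ W)); exact: memv_line.
Qed.

Definition convex_fun F :=
  convex_function [set: convex_lmodType V] F.

(* The differential depends only on the topology, not on the choice of norm. *)
Definition grad F x : V := \row_(i < n) ('d F x) (delta_mx ord0 i).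

Definition C11loc F :=
  (forall x, differentiable F x) /\
  (forall (c : V) (r : R), exists L : R, forall x y,
     enorm (x - c) <= r -> enorm (y - c) <= r ->
     enorm (grad F x - grad F y) <= L * enorm (x - y)).

Definition subdiff F x : set V :=
  [set u | forall y, F x + dot u (y - x) <= F y].

Definition subdiff_span F : {vspace V} :=
  vspan [set v | exists x y u w,
    [/\ subdiff F x u, subdiff F y w & v = u - w]].

(* Real-valued sup: faithful as soon as g has a convex minorant. *)
Definition conv_env g : V -> R := fun x =>
  sup [set phi x | phi in [set phi : V -> R |
         convex_fun phi /\ (forall y, phi y <= g y)]].

Definition differences (xi : V -> V) S : set V :=
  [set v | exists y z, [/\ S y, S z & v = xi y - xi z]].

Definition supnorm S (xi : V -> V) : R := sup [set enorm (xi y) | y in S].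

(* P^{-1}(B_X(0, r)), when P takes its values in X. *)
Definition preball (P : V -> V) (r : R) : set V := [set x | enorm (P x) <= r].

Lemma first_index_subproof v : exists k : nat, (0 < k)%N && (enorm v <= k%:R).
Proof.
exists (Num.truncn (enorm v)).+1; rewrite ltn0Sn /=; apply: ltW.
exact: truncnS_gt.
Qed.

Definition first_index (P : V -> V) y : nat := ex_minn (first_index_subproof (P y)).

(* The sequence A is indexed by the positive integers: A 0 is never used. *)
Definition admissible (X : {vspace V}) (P : V -> V) (S : set V)
    (t : V -> R) (xi : V -> V) (A : nat -> R) :=
  [/\ forall k, (0 < k)%N -> 2 <= A k,
      vspan (differences xi S) = X &
      forall (k : nat) (z y x : V), (0 < k)%N -> S z ->
        (S `&` preball P k%:R) y -> preball P (4 * k)%:R x ->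
        t z + dot (xi z) (x - z) <=
        t y + dot (xi y) (x - y) + A k / 2 * enorm (P (x - y)) ^+ 2].

(* Real-valued inf: faithful as soon as the family is bounded below at x.
   M is meant to be sup |xi|; a sup over a subset of S ignores the size of xi on
   the rest of S and can make the formula fail unless A is enlarged. *)
Definition conv_formula (P : V -> V) (S : set V) (t : V -> R) (xi : V -> V)
    (A : nat -> R) (M : R) : V -> R :=
  conv_env (fun x => inf [set t y + dot (xi y) (x - y) +
    1 / 2 * (A (first_index P y) + 4 * M + 1) * enorm (P (x - y)) ^+ 2
    | y in S]).

Definition is_extension (S : set V) (X : {vspace V}) (f : V -> R) (G : V -> V)
    (F : V -> R) :=
  [/\ convex_fun F, C11loc F, forall y, S y -> F y = f y,
      forall y, S y -> grad F y = G y & subdiff_span F = X].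

(* E^* and the values t, xi on it. *)
Definition add_points {m} (S : set V) (p : 'I_m -> V) : set V := S `|` range p.

Definition add_values {T : Type} {m} (g : V -> T) (p : 'I_m -> V) (b : 'I_m -> T)
    : V -> T :=
  fun y => if [pick j | p j == y] is Some j then b j else g y.

(* Distinctness of the p_j is what makes add_values equal to b j at p j. *)
Definition new_points {m} (S : set V) (p : 'I_m -> V) :=
  injective p /\ (forall j, ~ S (p j)).

End Euclidean.

(* Main.v *)
(* F is the convex envelope of g x = inf_y (l_y x + c_y x), where
   l_y x = t_y + <xi_y, x - y> and c_y vanishes at y, is locally semiconcave and
   exceeds the slack in l_z <= l_y + c_y by at least |P(x - y)|^2 / 2. The slack
   keeps near-minimizing y's bounded, so g is locally semiconcave along X. As
   the differences of the xi_y span X, g grows linearly in |P x| up to an affine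
   function, so a point of the convex hull of the graph of g lying close to the
   graph of F carries a fixed fraction of its weight over a bounded set; moving
   that part alone transfers the second-difference bound from g to F. For a
   convex function, such a bound gives C^{1,1}_loc. When xi is bounded, c_y may be
   quadratic, which is the formula of the theorem; in general a term growing
   with A is added. Conversely, A_k comes from a Lipschitz constant of grad F on
   the ball of radius 4k, and the p_j are chosen greedily so that each
   grad F p_j leaves the span of the previous gradient differences. *)
Require Import Defs.
From HB Require Import structures.
From mathcomp Require Import all_boot all_order all_algebra.
From mathcomp Require Import all_classical all_reals all_analysis.
From mathcomp Require Import ring lra.

Set Implicit Arguments.
Unset Strict Implicit.
Unset Printing Implicit Defensive.

Import Order.TTheory GRing.Theory Num.Theory.
Import numFieldNormedType.Exports.

Local Open Scope classical_set_scope.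
Local Open Scope ring_scope.

(** * Euclidean structure and orthogonal projections *)

Section Euclid.
Context {R : realType} {n : nat}.
Local Notation V := 'rV[R]_n.
Implicit Types (u v w x y h : V) (a : R).

Lemma dotC u v : dot u v = dot v u.
Proof. by apply: eq_bigr => i _; rewrite mulrC. Qed.

Lemma dotDl u v w : dot (u + v) w = dot u w + dot v w.
Proof.
by rewrite /dot -big_split; apply: eq_bigr => i _; rewrite !mxE mulrDl.
Qed.

Lemma dotZl a u v : dot (a *: u) v = a * dot u v.
Proof.
by rewrite /dot mulr_sumr; apply: eq_bigr => i _; rewrite !mxE mulrA.
Qed.

Lemma dotDr u v w : dot w (u + v) = dot w u + dot w v.
Proof. by rewrite dotC dotDl !(dotC w). Qed.

Lemma dotZr a u v : dot v (a *: u) = a * dot v u.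
Proof. by rewrite dotC dotZl dotC. Qed.

Lemma dotNl u v : dot (- u) v = - dot u v.
Proof. by rewrite -scaleN1r dotZl mulN1r. Qed.

Lemma dotNr u v : dot u (- v) = - dot u v.
Proof. by rewrite dotC dotNl dotC. Qed.

Lemma dotBl u v w : dot (u - v) w = dot u w - dot v w.
Proof. by rewrite dotDl dotNl. Qed.

Lemma dotBr u v w : dot w (u - v) = dot w u - dot w v.
Proof. by rewrite dotDr dotNr. Qed.

Lemma dot0l u : dot 0 u = 0.
Proof. by rewrite -(scale0r 0) dotZl mul0r. Qed.

Lemma dot0r u : dot u 0 = 0.
Proof. by rewrite dotC dot0l. Qed.

Lemma dot_suml (I : Type) (s : seq I) (g : I -> V) u :
  dot (\sum_(i <- s) g i) u = \sum_(i <- s) dot (g i) u.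
Proof.
elim/big_rec2 : _ => [|i x y _ <-]; first exact: dot0l.
by rewrite dotDl.
Qed.

Lemma dot_delta u i : dot u (delta_mx ord0 i) = u ord0 i.
Proof.
rewrite /dot (bigD1 i) //= !mxE !eqxx mulr1 big1 ?addr0 // => j ji.
by rewrite !mxE (negbTE ji) andbF mulr0.
Qed.

Lemma dotvv_ge0 u : 0 <= dot u u.
Proof. by apply: sumr_ge0 => i _; rewrite -expr2 sqr_ge0. Qed.

Lemma dotvv_eq0 u : dot u u = 0 -> u = 0.
Proof.
move=> /eqP; rewrite psumr_eq0; last by move=> i _; rewrite -expr2 sqr_ge0.
move=> /allP u0; apply/rowP => i; apply/eqP; rewrite mxE.
by have := u0 i (mem_index_enum i); rewrite /= -expr2 sqrf_eq0.
Qed.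

Lemma enorm_ge0 u : 0 <= enorm u.
Proof. exact: sqrtr_ge0. Qed.

Lemma enorm_sqr u : enorm u ^+ 2 = dot u u.
Proof. by rewrite sqr_sqrtr // dotvv_ge0. Qed.

Lemma enorm0 : enorm (0 : V) = 0.
Proof. by rewrite /enorm dot0l sqrtr0. Qed.

Lemma enorm_eq0 u : enorm u = 0 -> u = 0.
Proof. by move=> u0; apply: dotvv_eq0; rewrite -enorm_sqr u0 expr0n. Qed.

Lemma enormZ a u : enorm (a *: u) = `|a| * enorm u.
Proof.
by rewrite /enorm dotZl dotZr mulrA -expr2 sqrtrM ?sqr_ge0 // sqrtr_sqr.
Qed.

Lemma enormN u : enorm (- u) = enorm u.
Proof. by rewrite -scaleN1r enormZ normrN1 mul1r. Qed.

Lemma enormB u v : enorm (u - v) = enorm (v - u).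
Proof. by rewrite -enormN opprB. Qed.

(** Cauchy-Schwarz, by expanding the squared norm of [enorm v *: u - enorm u *: v]; the two zero
    cases are split off because the result is divided by both norms. *)
Lemma dot_le u v : dot u v <= enorm u * enorm v.
Proof.
have [->|v0] := eqVneq v 0; first by rewrite dot0r enorm0 mulr0.
have [->|u0] := eqVneq u 0; first by rewrite dot0l enorm0 mul0r.
have up : 0 < enorm u.
  by rewrite lt_neqAle enorm_ge0 andbT eq_sym; apply: contra_neq u0 => /enorm_eq0.
have vp : 0 < enorm v.
  by rewrite lt_neqAle enorm_ge0 andbT eq_sym; apply: contra_neq v0 => /enorm_eq0.
have := dotvv_ge0 (enorm v *: u - enorm u *: v).
rewrite dotBl !dotBr !dotZl !dotZr -!enorm_sqr (dotC v u) => H.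
have : 0 <= (enorm u * enorm v) * (enorm u * enorm v - dot u v) by nra.
by rewrite pmulr_rge0 ?mulr_gt0 // subr_ge0.
Qed.

Lemma normr_dot_le u v : `|dot u v| <= enorm u * enorm v.
Proof. by rewrite ler_norml lerNl -dotNl -{1}(enormN u) !dot_le. Qed.

Lemma enormD u v : enorm (u + v) <= enorm u + enorm v.
Proof.
rewrite -ler_sqr ?nnegrE ?addr_ge0 ?enorm_ge0 // enorm_sqr dotDl !dotDr.
rewrite -!enorm_sqr (dotC v u).
have := dot_le u v; nra.
Qed.

Lemma enorm_parallelogram u v :
  enorm (u + v) ^+ 2 + enorm (u - v) ^+ 2 = 2 * enorm u ^+ 2 + 2 * enorm v ^+ 2.
Proof. by rewrite !enorm_sqr !(dotDl, dotDr, dotNl, dotNr); ring. Qed.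

Lemma coord_le_enorm u i : `|u ord0 i| <= enorm u.
Proof.
rewrite -dot_delta (le_trans (normr_dot_le _ _)) //.
by rewrite /enorm dot_delta !mxE !eqxx sqrtr1 mulr1.
Qed.

Lemma enorm_le_sum u : enorm u <= \sum_(i < n) `|u ord0 i|.
Proof.
have s0 : 0 <= \sum_(i < n) `|u ord0 i| by apply: sumr_ge0.
rewrite -ler_sqr ?nnegrE ?enorm_ge0 // enorm_sqr expr2 mulr_suml.
apply: ler_sum => i _; rewrite -expr2 -real_normK ?num_real // expr2.
by rewrite ler_wpM2l // (bigD1 i) //= lerDl sumr_ge0.
Qed.

Lemma linspan_incl (S : set V) v : S v -> linspan S v.
Proof.
move=> Sv; exists 1%N, (fun=> 1), (fun=> v); split => //.
by rewrite big_ord1 scale1r.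
Qed.

Lemma mem_vspan (S : set V) v : v \in vspan S <-> linspan S v.
Proof. by rewrite -vspanE. Qed.

Lemma vspan_sub (S : set V) (X : {vspace V}) :
  (forall v, S v -> v \in X) -> (vspan S <= X)%VS.
Proof.
move=> SX; apply/subvP => v /mem_vspan[m [c [s [Ss ->]]]].
by apply: memv_suml => i _; rewrite memvZ // SX.
Qed.

Lemma vspan_incl (S : set V) v : S v -> v \in vspan S.
Proof. by move=> Sv; apply/mem_vspan/linspan_incl. Qed.

Lemma vspan_mono (S T : set V) : S `<=` T -> (vspan S <= vspan T)%VS.
Proof. by move=> ST; apply: vspan_sub => v /ST; exact: vspan_incl. Qed.

Lemma memv_sub_via (W : {vspace V}) w u v :
  u - w \in W -> v - w \in W -> u - v \in W.
Proof.
by move=> uW vW; rewrite -[u](subrK w) -addrA -(opprB v w) memvB.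
Qed.

Section Projection.
Variables (X : {vspace V}) (P : V -> V).
Hypothesis hP : is_orthoproj X P.

Lemma proj_mem x : P x \in X.
Proof. by case: (hP x). Qed.

(** [P x - y] lies in [X] and is orthogonal to [X]. The linearity of [P], which [is_orthoproj] does
    not state, is deduced from this. *)
Lemma proj_uniq x y : y \in X -> (forall v, v \in X -> dot (x - y) v = 0) ->
  P x = y.
Proof.
move=> yX xy; have [PX xP] := hP x; apply/eqP; rewrite -subr_eq0; apply/eqP.
have dX : P x - y \in X by rewrite memvB.
apply: dotvv_eq0; have := xy _ dX; have := xP _ dX.
by rewrite !dotBl => ? ?; lra.
Qed.

Lemma proj_linear a x y : P (a *: x + y) = a *: P x + P y.
Proof.
apply: proj_uniq => [|v vX]; first by rewrite memvD ?memvZ ?proj_mem.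
have := (hP x).2 _ vX; have := (hP y).2 _ vX.
rewrite !dotBl !dotDl !dotZl => ? H.
have -> : a * dot x v + dot y v - (a * dot (P x) v + dot (P y) v) =
  a * (dot x v - dot (P x) v) + (dot y v - dot (P y) v) by ring.
by rewrite H; lra.
Qed.

Lemma projD x y : P (x + y) = P x + P y.
Proof. by have := proj_linear 1 x y; rewrite !scale1r. Qed.

Lemma proj0 : P 0 = 0.
Proof. by apply: (addrI (P 0)); rewrite -projD !addr0. Qed.

Lemma projZ a x : P (a *: x) = a *: P x.
Proof. by have := proj_linear a x 0; rewrite proj0 !addr0. Qed.

Lemma projN x : P (- x) = - P x.
Proof. by rewrite -scaleN1r projZ scaleN1r. Qed.

Lemma projB x y : P (x - y) = P x - P y.
Proof. by rewrite projD projN. Qed.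

Lemma proj_id x : P (P x) = P x.
Proof.
by apply: proj_uniq => [|v _]; rewrite ?proj_mem // subrr dot0l.
Qed.

Lemma dot_proj u x : u \in X -> dot u x = dot u (P x).
Proof.
by move=> uX; have := (hP x).2 _ uX; rewrite dotC dotBr => /subr0_eq.
Qed.

Lemma proj_adj u x : dot (P u) x = dot u (P x).
Proof. by rewrite dot_proj ?proj_mem // dotC [RHS]dotC -dot_proj ?proj_mem. Qed.

Lemma enorm_proj x : enorm (P x) <= enorm x.
Proof.
rewrite -ler_sqr ?nnegrE ?enorm_ge0 // !enorm_sqr.
have := dotvv_ge0 (x - P x); rewrite dotBl !dotBr (dotC x).
have := dot_proj x (proj_mem x); lra.
Qed.

(** [u - P u] is killed by [P], so it is orthogonal to [u]; lying also in the complement of [X], it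
    is orthogonal to itself. *)
Lemma orthogonal_mem u : (forall h, P h = 0 -> dot u h = 0) -> u \in X.
Proof.
move=> u0; have k0 : P (u - P u) = 0 by rewrite projB proj_id subrr.
suff /subr0_eq -> : u - P u = 0 by exact: proj_mem.
apply: dotvv_eq0; rewrite dotBl u0 // dot_proj ?proj_mem // k0 dot0r.
by rewrite subrr.
Qed.

End Projection.
End Euclid.

(** * Differentiability of convex functions *)

Section Differential.
Context {R : realType} {V W : normedModType R}.

Let littleoE (f df : V -> W) x : (f \o shift x = cst (f x) + df +o_ 0 id) <->
  forall e : R, 0 < e ->
    \forall h \near (0 : V), `|f (x + h) - f x - df h| <= e * `|h|.
Proof.
split=> [/eqaddoP fo e /fo|fo]; last apply/eqaddoP => e /fo.
  by apply: filterS => h; rewrite !fctE /= opprD addrA (addrC h).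
by apply: filterS => h; rewrite !fctE /= opprD addrA (addrC h).
Qed.

Lemma differentiable_dist (f : V -> W) x : differentiable f x ->
  forall e : R, 0 < e -> exists2 d : R, 0 < d &
    forall h, `|h| < d -> `|f (x + h) - f x - 'd f x h| <= e * `|h|.
Proof. by move=> /diff_locallyP[_ /littleoE] fo e /fo /nbhs_norm0P. Qed.

Lemma dist_differentiable (f : V -> W) (df : {linear V -> W}) x :
  continuous df ->
  (forall e : R, 0 < e -> exists2 d : R, 0 < d &
    forall h, `|h| < d -> `|f (x + h) - f x - df h| <= e * `|h|) ->
  differentiable f x.
Proof.
move=> dc fo; have Fo : f \o shift x = cst (f x) + df +o_ 0 id.
  by apply/littleoE => e /fo[d d0 fd]; apply/nbhs_norm0P; exists d.
by apply/diff_locallyP; rewrite (diff_unique dc Fo).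
Qed.

End Differential.

(** * Subgradients, gradients and second differences of convex functions *)

Section Convexity.
Context {R : realType} {n : nat}.
Local Notation V := 'rV[R]_n.
Implicit Types (F : V -> R) (u v x y h : V) (a s t : R).

Lemma convex_funP F : convex_fun F <->
  (forall t x y, 0 <= t <= 1 ->
    F (t *: x + (1 - t) *: y) <= t * F x + (1 - t) * F y).
Proof.
split=> [cF t x y t01|cF t x y _ _].
  have t01' : Itv.spec (@Itv.num_sem R)
    (Itv.Real `[0%Z, 1%Z]) t.
    by apply/andP; split; rewrite ?num_real //= in_itv.
  by have := cF (Itv.mk t01') x y (mem_set I) (mem_set I).
by apply: cF; rewrite ge0 le1.
Qed.

Lemma convex_mid F x y : convex_fun F ->
  F (2^-1 *: (x + y)) <= 2^-1 * F x + 2^-1 * F y.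
Proof.
move=> /convex_funP cF; have := cF 2^-1 x y.
have -> : 1 - 2^-1 = 2^-1 :> R by lra.
by rewrite scalerDr; apply; lra.
Qed.

Lemma grad_dot F x h : 'd F x h = dot (grad F x) h.
Proof.
rewrite [in LHS](row_sum_delta h) linear_sum /dot; apply: eq_bigr => i _.
by rewrite linearZ /= mxE mulrC.
Qed.

Lemma enorm_le_mx_norm h : enorm h <= n%:R * `|h|.
Proof.
rewrite (le_trans (enorm_le_sum h)) //.
rewrite (le_trans (y := \sum_(i < n) `|h|)) //; last first.
  by rewrite sumr_const card_ord mulr_natl.
apply: ler_sum => i _; rewrite [leRHS]/Num.Def.normr /= mx_normrE.
by apply/bigmax_geP; right => /=; exists (ord0, i).
Qed.

Lemma dot_is_linear u : linear (dot u : V -> R).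
Proof. by move=> a x y; rewrite dotDr dotZr. Qed.

HB.instance Definition _ u :=
  GRing.isLinear.Build R V R _ (dot u) (dot_is_linear u).

Lemma dot_continuous u : continuous (dot u : V -> R).
Proof.
apply/linear_bounded_continuous/bounded_funP => r.
exists (enorm u * (n%:R * r)) => x xr.
rewrite (le_trans (normr_dot_le _ _)) // ler_wpM2l ?enorm_ge0 //.
by rewrite (le_trans (enorm_le_mx_norm _)) // ler_wpM2l.
Qed.

Lemma differentiable_of_quadratic_error F x u (K d : R) : 0 < d ->
  (forall h, enorm h <= d ->
    `|F (x + h) - F x - dot u h| <= K * enorm h ^+ 2) ->
  differentiable F x.
Proof.
move=> d0 Fq.
apply: (@dist_differentiable _ _ _ _ (dot u)); first exact: dot_continuous.
move=> e e0.
(* [c] compares [enorm] with the max norm; the summand 1 keeps it positive when [n] is 0. *)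
pose c := n%:R + 1 : R.
have c0 : 0 < c by rewrite ltr_wpDl ?ler0n.
pose B : R := (`|K| + 1) * c ^+ 2.
have B0 : 0 < B by rewrite mulr_gt0 ?exprn_gt0 // ltr_wpDl.
have eB0 : 0 < e / B by rewrite divr_gt0.
have dc0 : 0 < d / c by rewrite divr_gt0.
exists (Num.min (d / c) (e / B)); first by rewrite lt_min dc0.
move=> h; rewrite lt_min => /andP[/ltW h1 /ltW h2].
have hc := enorm_le_mx_norm h; have k0 := normr_ge0 h.
move: `|h| h1 h2 hc k0 => k h1 h2 hn k0.
have hc : enorm h <= c * k.
  by rewrite (le_trans hn) // ler_wpM2r // lerDl.
have hd : enorm h <= d.
  by rewrite (le_trans hc) // mulrC -ler_pdivlMr.
apply: (le_trans (Fq h hd)).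
apply: (@le_trans _ _ (B * k * k)); last first.
  by rewrite ler_wpM2r // mulrC -ler_pdivlMr.
apply: (@le_trans _ _ ((`|K| + 1) * enorm h ^+ 2)).
  by rewrite ler_wpM2r ?sqr_ge0 // (le_trans (ler_norm K)) // lerDl.
have -> : B * k * k = (`|K| + 1) * (c * k) ^+ 2 by rewrite /B; ring.
rewrite ler_wpM2l ?addr_ge0 //.
by rewrite ler_sqr ?nnegrE ?enorm_ge0 // mulr_ge0 // ltW.
Qed.

Lemma differentiable_line F x h (e : R) : differentiable F x -> 0 < e ->
  exists2 d : R, 0 < d & forall s, 0 < s -> s < d ->
    `|F (x + s *: h) - F x - s * dot (grad F x) h| <= s * e.
Proof.
move=> dF e0.
have c0 : 0 < `|h| + 1 by rewrite ltr_wpDl.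
have [d d0 dP] :=
  differentiable_dist dF (divr_gt0 e0 c0).
exists (d / (`|h| + 1)); first by rewrite divr_gt0.
move=> s s0 sd.
have /dP : `|s *: h| < d.
  rewrite normrZ gtr0_norm //.
  rewrite (@le_lt_trans _ _ (s * (`|h| + 1))) //; first by rewrite ler_pM2l ?lerDl.
  by rewrite -ltr_pdivlMr.
rewrite grad_dot dotZr.
move=> /le_trans; apply; rewrite normrZ gtr0_norm // mulrCA ler_pM2l //.
by rewrite mulrAC ler_pdivrMr // ler_pM2l // lerDl.
Qed.

(** Along the difference [w] of the two vectors, the subgradient inequality gains [s * dot w w] over
    the linearization, whose error is at most [s * e]. *)
Lemma subdiff_grad F x u : differentiable F x -> subdiff F x u -> u = grad F x.
Proof.
move=> dF Fu; apply/eqP; rewrite -subr_eq0; apply/eqP.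
set w := u - _; apply: dotvv_eq0; apply/eqP.
rewrite eq_le dotvv_ge0 andbT; apply/ler_addgt0Pr => e e0; rewrite add0r.
have [d d0 dP] := differentiable_line w dF e0.
have d2 : 0 < d / 2 by rewrite divr_gt0.
have /dP : d / 2 < d by rewrite ltr_pdivrMr // ltr_pMr // ltr1n.
move=> /(_ d2) /ler_normlW; set s := d / 2 in d2 * => sP.
have := Fu (x + s *: w); rewrite addrAC subrr add0r dotZr => Fw.
by rewrite -(ler_pM2l d2) {1}/w dotBl; lra.
Qed.

Lemma grad_subdiff F x : convex_fun F -> differentiable F x ->
  subdiff F x (grad F x).
Proof.
move=> /convex_funP cF dF y; apply/ler_addgt0Pr => e e0.
have [d d0 dP] := differentiable_line (y - x) dF e0.
pose s := Num.min (d / 2) 1.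
have s0 : 0 < s by rewrite lt_min divr_gt0 //= ltr01.
have s1 : s <= 1 by rewrite ge_min lexx orbT.
have sd : s < d by rewrite gt_min ltr_pdivrMr // ltr_pMr // ltr1n.
have := dP _ s0 sd; rewrite ler_norml => /andP[sP _].
have := cF s y x; rewrite (ltW s0) s1 => /(_ isT).
have -> : s *: y + (1 - s) *: x = x + s *: (y - x).
  by rewrite scalerBl scale1r scalerBr; rewrite addrCA addrA addrC addrA.
by move=> cFs; rewrite -(ler_pM2l s0); nra.
Qed.

(** Backward difference quotients lie below forward ones, so the infimum of the forward ones is a
    slope that serves on both sides. *)
Lemma convex_line_slope F x e : convex_fun F ->
  exists a, forall s, F x + a * s <= F (x + s *: e).
Proof.
move=> /convex_funP cF.
have slope s t : 0 < s -> 0 < t ->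
    (F x - F (x - t *: e)) / t <= (F (x + s *: e) - F x) / s.
  move=> s0 t0; have st0 : 0 < s + t by exact: addr_gt0.
  rewrite ler_pdivrMr // mulrAC ler_pdivlMr //.
  have := cF (t / (s + t)) (x + s *: e) (x - t *: e).
  have tst : 0 <= t / (s + t) <= 1.
    rewrite divr_ge0 ?(ltW t0) ?(ltW st0) //= ler_pdivrMr // mul1r lerDr.
    exact: ltW.
  have -> : 1 - t / (s + t) = s / (s + t).
    by apply/eqP; rewrite subr_eq -mulrDl divff // gt_eqF.
  have -> : (t / (s + t)) *: (x + s *: e) + (s / (s + t)) *: (x - t *: e) = x.
    rewrite !scalerDr addrACA -scalerDl -mulrDl addrC (addrC t) divff ?gt_eqF //.
    rewrite scalerN !scalerA mulrAC (mulrAC s) (mulrC s t) subrr add0r.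
    exact: scale1r.
  move=> /(_ tst); rewrite mulrAC (mulrAC s) -mulrDl ler_pdivlMr // => H.
  lra.
pose A := [set (F (x + s *: e) - F x) / s | s in [set s | 0 < s]].
have A0 : A !=set0 by exists ((F (x + 1 *: e) - F x) / 1); exists 1 => //=.
have lbA t : 0 < t -> lbound A ((F x - F (x - t *: e)) / t).
  by move=> t0 _ [s /= s0 <-]; exact: slope.
exists (inf A) => s; have [s0|s0|->] := ltgtP s 0.
- have ms0 : 0 < - s by rewrite oppr_gt0.
  have := lb_le_inf A0 (lbA _ ms0).
  by rewrite scaleNr opprK ler_pdivrMr // mulrN; lra.
- have : inf A <= (F (x + s *: e) - F x) / s.
    apply: ge_inf; last by exists s.
    by exists ((F x - F (x - 1 *: e)) / 1); exact: lbA.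
  by rewrite ler_pdivlMr // lerBrDl.
- by rewrite mulr0 scale0r !addr0.
Qed.

(* Convexity bounds [F (x + h) - F x - <u, h>], with u the vector of partial
   derivatives, by its values on multiples of the coordinate vectors. *)
Lemma differentiable_second_diff F x (K d : R) : convex_fun F -> 0 < d ->
  (forall h, enorm h <= d ->
    F (x + h) + F (x - h) <= 2 * F x + K * enorm h ^+ 2) ->
  differentiable F x.
Proof.
move=> cF d0 FK.
have [a aP] := choice (fun i : 'I_n => convex_line_slope x (delta_mx ord0 i) cF).
pose u : V := \row_i a i.
pose r h := F (x + h) - F x - dot u h.
have r_mid h h' : r (h + h') <= 2^-1 * r (2 *: h) + 2^-1 * r (2 *: h').
  have := convex_mid (x + 2 *: h) (x + 2 *: h') cF.
  have -> : 2^-1 *: (x + 2 *: h + (x + 2 *: h')) = x + (h + h').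
    rewrite addrACA -scalerDr -(scaler_nat 2 x : _ = x + x) -scalerDr scalerA.
    by rewrite mulVf ?pnatr_eq0 // scale1r.
  by rewrite /r dotDr !dotZr; lra.
(* The slope bound at [- s] estimates F (x - h) from below, which turns the second-difference bound
   into an upper bound for [r]. *)
have r_line i s : `|s| <= d -> r (s *: delta_mx ord0 i) <= `|K| * s ^+ 2.
  move=> sd; set h := s *: _.
  have hs : enorm h = `|s|.
    by rewrite /h enormZ /enorm dot_delta !mxE !eqxx sqrtr1 mulr1.
  have := FK h; rewrite hs real_normK ?num_real // => /(_ sd).
  have := aP i (- s); rewrite scaleNr -/h.
  have dh : dot u h = s * a i by rewrite dotZr dot_delta mxE.
  have := ler_norm K => K1; have := sqr_ge0 s => s2.
  rewrite /r dh => ? ?.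
  have : K * s ^+ 2 <= `|K| * s ^+ 2 by rewrite ler_wpM2r.
  lra.
pose part (s : seq 'I_n) h := \sum_(i <- s) h ord0 i *: (delta_mx ord0 i : V).
(* Coordinates are added one at a time; each use of [r_mid] doubles the arguments, so the admissible
   radius is halved. *)
have partP (s : seq 'I_n) : exists C e : R, 0 < e /\
    forall h, enorm h <= e -> r (part s h) <= C * enorm h ^+ 2.
  elim: s => [|i s [C [e [e0 IH]]]].
    by exists 0, 1; split => // h _; rewrite /part big_nil /r addr0 dot0r; lra.
  exists (2 * `|K| + 2 * C), (Num.min (d / 2) (e / 2)).
  split; first by rewrite lt_min !divr_gt0.
  move=> h; rewrite le_min => /andP[hd he].
  rewrite /part big_cons (le_trans (r_mid _ _)) //.
  have -> : 2 *: (\sum_(j <- s) h ord0 j *: (delta_mx ord0 j : V)) = part s (2 *: h).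
    by rewrite /part scaler_sumr; apply: eq_bigr => j _; rewrite mxE scalerA.
  have n2 : enorm (2 *: h) = 2 * enorm h by rewrite enormZ ger0_norm.
  have hi := coord_le_enorm h i.
  rewrite scalerA.
  have hi2 : `|2 * h ord0 i| <= d.
    by rewrite normrM ger0_norm // mulrC -ler_pdivlMr // (le_trans hi).
  have he2 : enorm (2 *: h) <= e by rewrite n2 mulrC -ler_pdivlMr.
  have r1 := r_line i _ hi2; have := IH _ he2; rewrite n2 => r2.
  have : (h ord0 i) ^+ 2 <= enorm h ^+ 2.
    by rewrite -real_normK ?num_real // ler_sqr ?nnegrE ?enorm_ge0.
  have := normr_ge0 K => K1 h2.
  have : `|K| * (h ord0 i) ^+ 2 <= `|K| * enorm h ^+ 2 by rewrite ler_wpM2l.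
  nra.
have [C [e [e0 Cr]]] := partP (index_enum 'I_n).
have partE h : part (index_enum 'I_n) h = h by rewrite [RHS]row_sum_delta.
apply: (@differentiable_of_quadratic_error F x u C e) => // h he.
rewrite -/(r h) ler_norml; have := Cr h he; rewrite partE => ->; rewrite andbT.
(* Lower bound: [r] vanishes at 0, which is the midpoint of [h] and [- h], so [r h] is at least
   [- r (- h)]. *)
have := Cr (- h); rewrite enormN partE => /(_ he).
have := r_mid (2^-1 *: h) (2^-1 *: (- h)).
rewrite scalerN subrr scalerN !scalerA divff ?pnatr_eq0 // scale1r /r addr0 dot0r.
lra.
Qed.

(** For the Lipschitz bound, F is evaluated at a point [z] at distance |x - y| from [y], in the
    direction of [grad F y - grad F x]. The tangent at [y] bounds F z from below, the second
    difference at [x] bounds it from above, and the tangent at [x] bounds F y from below; together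
    they bound |x - y| times the gradient difference by a multiple of |z - x|^2. *)
Lemma C11loc_second_diff F : convex_fun F ->
  (forall r, exists K, forall x h, enorm x <= r -> enorm h <= r ->
    F (x + h) + F (x - h) <= 2 * F x + K * enorm h ^+ 2) ->
  C11loc F.
Proof.
move=> cF FK.
have dF x : differentiable F x.
  have x1 : 0 < enorm x + 1 by rewrite ltr_wpDl ?enorm_ge0.
  have [K KP] := FK (enorm x + 1).
  by apply: (differentiable_second_diff cF x1) => h hx; apply: KP; rewrite ?lerDl.
(* The radius covers [x], of norm at most |c| + |r|, and the step [z - x], of norm at most 2 |x - y|
   <= 4 |r|. *)
split => // c r; have [K KP] := FK (enorm c + 4 * `|r|).
exists (4 * `|K|) => x y xr yr.
set u := grad F x; set v := grad F y.
have xcr : enorm x <= enorm c + `|r|.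
  rewrite -[x](subrK c) addrC (le_trans (enormD _ _)) // lerD2l.
  by rewrite (le_trans xr) ?ler_norm.
have xyr : enorm (x - y) <= 2 * `|r|.
  rewrite -(subrKA c) (le_trans (enormD _ _)) // (enormB c).
  have := ler_norm r; lra.
have [uv|uv] := eqVneq (u - v) 0.
  by rewrite uv enorm0 !mulr_ge0 ?enorm_ge0.
have [xy|xy] := eqVneq (x - y) 0.
  by move: uv; rewrite /u /v (subr0_eq xy) subrr eqxx.
have w0 : 0 < enorm (v - u).
  rewrite enormB lt_neqAle enorm_ge0 andbT eq_sym.
  by apply: contra_neq uv => /enorm_eq0.
have s0 : 0 < enorm (x - y).
  by rewrite lt_neqAle enorm_ge0 andbT eq_sym; apply: contra_neq xy => /enorm_eq0.
set s := enorm (x - y) in s0 xyr *.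
pose z := y + (s / enorm (v - u)) *: (v - u).
have zy : enorm (z - y) = s.
  rewrite /z addrAC subrr add0r enormZ ger0_norm ?divr_ge0 ?enorm_ge0 //.
  by rewrite divfK ?gt_eqF.
have zx : enorm (z - x) <= 2 * s.
  by rewrite -(subrKA y) (le_trans (enormD _ _)) // zy (enormB y) -/s; lra.
have Fz : F z <= F x + dot u (z - x) + `|K| * enorm (z - x) ^+ 2.
  have := KP x (z - x); rewrite subrKC.
  have -> : enorm x <= enorm c + 4 * `|r| by have := normr_ge0 r; lra.
  have -> : enorm (z - x) <= enorm c + 4 * `|r| by have := enorm_ge0 c; lra.
  move=> /(_ isT isT).
  have := grad_subdiff cF (dF x) (x - (z - x)).
  rewrite addrAC subrr add0r dotNr -/u.
  have : K * enorm (z - x) ^+ 2 <= `|K| * enorm (z - x) ^+ 2.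
    by rewrite ler_wpM2r ?sqr_ge0 ?ler_norm.
  lra.
have Fvz := grad_subdiff cF (dF y) z; rewrite -/v in Fvz.
have Fuy := grad_subdiff cF (dF x) y; rewrite -/u in Fuy.
have dzx : dot u (z - x) = dot u (z - y) + dot u (y - x).
  by rewrite -dotDr subrKA.
have dw : dot (v - u) (z - y) = s * enorm (v - u).
  have -> : z - y = (s / enorm (v - u)) *: (v - u).
    by rewrite /z addrAC subrr add0r.
  by rewrite dotZr -enorm_sqr expr2 mulrA (divfK (lt0r_neq0 w0)).
have zx2 : enorm (z - x) ^+ 2 <= (2 * s) ^+ 2.
  by rewrite ler_sqr ?nnegrE ?enorm_ge0 // mulr_ge0 // ltW.
have Kzx : `|K| * enorm (z - x) ^+ 2 <= `|K| * (2 * s) ^+ 2 by rewrite ler_wpM2l.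
rewrite enormB -(ler_pM2l s0) -dw.
have -> : s * (4 * `|K| * s) = `|K| * (2 * s) ^+ 2 by ring.
apply: le_trans Kzx; rewrite dotBl.
by clear -Fz Fvz Fuy dzx; clearbody u v z; lra.
Qed.

End Convexity.

(** * Convex envelopes *)

Section ConvexEnvelope.
Context {R : realType} {n : nat}.
Local Notation V := 'rV[R]_n.
Implicit Types (F g phi : V -> R) (u v x y h : V) (a s t : R).

Lemma convex_affine u a : convex_fun (fun x => a + dot u x).
Proof. by apply/convex_funP => t x y _; rewrite dotDr !dotZr; lra. Qed.

Let minorant g phi := convex_fun phi /\ forall y, phi y <= g y.

Let has_sup_minorant g phi x : minorant g phi ->
  has_sup [set psi x | psi in minorant g].
Proof.
move=> gphi; split; first by exists (phi x), phi.
by exists (g x) => _ [psi [_ psig] <-].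
Qed.

Lemma conv_env_ge g phi x : convex_fun phi -> (forall y, phi y <= g y) ->
  phi x <= conv_env g x.
Proof.
move=> cphi phig; have gphi : minorant g phi by [].
by apply: ub_le_sup; [have [] := has_sup_minorant x gphi|exists phi].
Qed.

Lemma conv_env_le g phi x : convex_fun phi -> (forall y, phi y <= g y) ->
  conv_env g x <= g x.
Proof.
move=> cphi phig; have gphi : minorant g phi by [].
by apply: ge_sup; [have [] := has_sup_minorant x gphi|move=> _ [psi [_ +] <-]].
Qed.

Lemma conv_env_convex g phi : convex_fun phi -> (forall y, phi y <= g y) ->
  convex_fun (conv_env g).
Proof.
move=> cphi phig; have gphi : minorant g phi by [].
apply/convex_funP => t x y t01; have [t0 t1] := andP t01.
apply: ge_sup; first by have [] := has_sup_minorant (t *: x + (1 - t) *: y) gphi.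
move=> _ [psi [cpsi psig] <-].
apply: (le_trans ((convex_funP psi).1 cpsi t x y t01)).
by rewrite lerD // ler_wpM2l ?subr_ge0 //; exact: conv_env_ge.
Qed.

(* A set of pairs (x, a) as below contains the convex hull of the graph of g. *)
Lemma conv_env_hull g (Q : V -> R -> Prop) (m : V -> R) x a :
  (forall y, Q y (g y)) ->
  (forall y b, Q y b -> m y <= b) ->
  (forall t y z b b', 0 <= t <= 1 -> Q y b -> Q z b' ->
     Q (t *: y + (1 - t) *: z) (t * b + (1 - t) * b')) ->
  conv_env g x < a -> exists2 b, Q x b & b < a.
Proof.
move=> Qg Qm Qc xa.
(* The lower boundary [q] of [Q] is a convex minorant of [g], hence lies below [conv_env g]; [m]
   keeps its infima finite. *)
pose q y := inf [set b | Q y b].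
have q0 y : [set b | Q y b] !=set0 by exists (g y); exact: Qg.
have qlb y : has_lbound [set b | Q y b] by exists (m y) => b /Qm.
have qQ y e : 0 < e -> exists2 b, Q y b & b < q y + e.
  by move=> e0; have [b] := inf_adherent e0 (conj (q0 y) (qlb y)); exists b.
have qle y b : Q y b -> q y <= b by move=> Qb; exact: ge_inf.
have cq : convex_fun q.
  apply/convex_funP => t y z t01; have [t0 t1] := andP t01.
  apply/ler_addgt0Pr => e e0.
  have [b Qb bq] := qQ y _ e0; have [b' Qb' bq'] := qQ z _ e0.
  apply: (le_trans (qle _ _ (Qc _ _ _ _ _ t01 Qb Qb'))).
  have -> : t * q y + (1 - t) * q z + e =
    t * (q y + e) + (1 - t) * (q z + e) by ring.
  by rewrite lerD // ler_wpM2l ?subr_ge0 // ltW.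
have xq : q x < a.
  by apply: le_lt_trans xa; apply: conv_env_ge => // y; exact: qle.
by have [b Qb bx] := inf_lt (q0 x) xq; exists b.
Qed.

End ConvexEnvelope.

(** * Envelope of an infimum of perturbed affine functions *)

Section Envelope.
Context {R : realType} {n : nat}.
Local Notation V := 'rV[R]_n.
Variables (X : {vspace V}) (P : V -> V) (hP : is_orthoproj X P).
Variables (S : set V) (t : V -> R) (xi : V -> V) (c : V -> V -> R).
Implicit Types (u v x y z h : V) (a r : R).

Let l y x := t y + dot (xi y) (x - y).
Let g x := inf [set l y x + c y x | y in S].
Let F := conv_env g.

Hypothesis S0 : S !=set0.
Hypothesis spanX : vspan (differences xi S) = X.
Hypothesis cyy : forall y, S y -> c y y = 0.
Hypothesis l_le : forall y z x, S y -> S z ->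
  l z x + 1 / 2 * enorm (P (x - y)) ^+ 2 <= l y x + c y x.
Hypothesis c_semiconcave : forall r, exists K, forall y x h, S y ->
  enorm (P y) <= r -> enorm (P x) <= r -> enorm (P h) <= r ->
  c y (x + h) + c y (x - h) <= 2 * c y x + K * enorm (P h) ^+ 2.

Let xiB y z : S y -> S z -> xi y - xi z \in X.
Proof. by move=> Sy Sz; rewrite -spanX; apply: vspan_incl; exists y, z. Qed.

Let lE y x : l y x = (t y - dot (xi y) y) + dot (xi y) x.
Proof. by rewrite /l dotBr; ring. Qed.

Let l_convex y : convex_fun (l y).
Proof.
have -> : l y = fun x => (t y - dot (xi y) y) + dot (xi y) x.
  by apply/funext => x; exact: lE.
exact: convex_affine.
Qed.

Let family_neq0 x : [set l y x + c y x | y in S] !=set0.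
Proof. by have [y Sy] := S0; exists (l y x + c y x), y. Qed.

Let l_le_family z x : S z -> lbound [set l y x + c y x | y in S] (l z x).
Proof.
move=> Sz _ [y Sy <-]; apply: le_trans (l_le x Sy Sz).
by rewrite lerDl mulr_ge0 ?sqr_ge0.
Qed.

Let l_le_g z x : S z -> l z x <= g x.
Proof. by move=> Sz; apply: lb_le_inf => //; exact: l_le_family. Qed.

Let g_le y x : S y -> g x <= l y x + c y x.
Proof.
move=> Sy; apply: ge_inf; last by exists y.
by exists (l y x); exact: l_le_family.
Qed.

Let l_le_F z x : S z -> l z x <= F x.
Proof. by move=> Sz; apply: conv_env_ge => // y; exact: l_le_g. Qed.

Let F_le_g x : F x <= g x.
Proof.
have [z Sz] := S0; apply: (@conv_env_le _ _ g (l z)) => // y; exact: l_le_g.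
Qed.

Let F_convex : convex_fun F.
Proof.
have [z Sz] := S0; apply: (@conv_env_convex _ _ g (l z)) => // y; exact: l_le_g.
Qed.

Let F_eq y : S y -> F y = t y.
Proof.
move=> Sy; have lyy : l y y = t y by rewrite /l subrr dot0r addr0.
apply/eqP; rewrite eq_le -{2}lyy l_le_F // andbT.
by rewrite (le_trans (F_le_g y)) // (le_trans (g_le y Sy)) // lyy cyy // addr0.
Qed.

Let c_ge0 y x : S y -> 0 <= c y x.
Proof.
move=> Sy; have := l_le x Sy Sy; have := sqr_ge0 (enorm (P (x - y))); lra.
Qed.

(** This is the second difference of [c y] centred at [y], where [c y] vanishes; the value at the
    reflected point is nonnegative and is dropped. *)
Let c_le y r : S y -> exists2 K, 0 <= K & forall x, enorm (P x) <= r ->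
  c y x <= K * enorm (P (x - y)) ^+ 2.
Proof.
move=> Sy; have [K KP] := c_semiconcave (enorm (P y) + `|r|).
exists `|K| => // x xr.
have xy : enorm (P (x - y)) <= enorm (P y) + `|r|.
  rewrite (projB hP) (le_trans (enormD _ _)) // enormN addrC lerD2l.
  by rewrite (le_trans xr) ?ler_norm.
have := KP y y (x - y) Sy; rewrite lerDl normr_ge0 => /(_ isT isT xy).
rewrite subrKC cyy // mulr0 add0r.
have := c_ge0 (y - (x - y)) Sy => ? ?.
have : K * enorm (P (x - y)) ^+ 2 <= `|K| * enorm (P (x - y)) ^+ 2.
  by rewrite ler_wpM2r ?sqr_ge0 ?ler_norm.
lra.
Qed.

Let sqr_le_bound a b : 0 <= a -> a ^+ 2 <= b -> a <= b + 1.
Proof. by move=> a0 ab; nra. Qed.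

(** A near-minimizing [y] for [g x] also competes at [x + h] and [x - h], so the bound for [c y]
    passes to [g]. The constant is uniform because such [y] have bounded projections. *)
Let g_semiconcave r : exists2 K, 0 <= K & forall x h,
  enorm (P x) <= r -> enorm (P h) <= r ->
  g (x + h) + g (x - h) <= 2 * g x + K * enorm (P h) ^+ 2.
Proof.
have [y0 Sy0] := S0.
have [K0 K00 K0P] := c_le r Sy0.
(* By [l_le] with [z := y0], half of |P(x - y)|^2 is at most [c y0 x + e'], and [e'] is at most 1;
   the last summand comes from [sqr_le_bound]. *)
pose B := 2 * (K0 * (r + enorm (P y0)) ^+ 2 + 1) + 1.
have [K KP] := c_semiconcave (`|r| + `|B|).
exists `|K| => // x h xr hr.
apply/ler_addgt0Pr => e e0.
pose e' := Num.min (e / 2) 1.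
have e'0 : 0 < e' by rewrite lt_min divr_gt0 //= ltr01.
have glb : has_lbound [set l y x + c y x | y in S].
  by exists (l y0 x); exact: l_le_family.
have [_ [y Sy <-] yg] := inf_adherent e'0 (conj (family_neq0 x) glb).
rewrite -/(g x) in yg.
have e'1 : e' <= 1 by rewrite ge_min lexx orbT.
have e'e : e' <= e / 2 by rewrite ge_min lexx.
have xy : enorm (P (x - y)) <= B.
  apply: sqr_le_bound; first exact: enorm_ge0.
  have := l_le x Sy Sy0; have := g_le x Sy0; have := K0P x xr.
  have : enorm (P (x - y0)) ^+ 2 <= (r + enorm (P y0)) ^+ 2.
    have xy0 : enorm (P (x - y0)) <= r + enorm (P y0).
      by rewrite (projB hP) (le_trans (enormD _ _)) // enormN lerD2r.
    by rewrite ler_sqr ?nnegrE ?enorm_ge0 // (le_trans (enorm_ge0 _) xy0).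
  move=> /(ler_wpM2l K00); lra.
have yr : enorm (P y) <= `|r| + `|B|.
  have -> : P y = P x - P (x - y) by rewrite (projB hP) subKr.
  rewrite (le_trans (enormD _ _)) // enormN lerD //.
    by rewrite (le_trans xr) ?ler_norm.
  by rewrite (le_trans xy) ?ler_norm.
have rB : r <= `|r| + `|B| by rewrite (le_trans (ler_norm r)) ?lerDl.
have := KP y x h Sy yr (le_trans xr rB) (le_trans hr rB).
have := g_le (x + h) Sy; have := g_le (x - h) Sy.
have : K * enorm (P h) ^+ 2 <= `|K| * enorm (P h) ^+ 2.
  by rewrite ler_wpM2r ?sqr_ge0 ?ler_norm.
rewrite (lE y (x + h)) (lE y (x - h)) !dotDr dotNr.
rewrite (lE y x) in yg; lra.
Qed.

(** Growth of [g] at rate [N] above an affine function. The condition on [v] makes its pairing with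
    [x] differ from that of any [xi z] by a quantity depending on [P x] only. *)
Let grows (N : V -> R) := exists v a e,
  [/\ forall z, S z -> v - xi z \in X, 0 < e &
      forall x, a + dot v x + e * N x <= g x].

Let grows0 : grows (fun=> 0).
Proof.
have [z Sz] := S0; exists (xi z), (t z - dot (xi z) z), 1.
split => // [z' Sz'|x]; first exact: xiB.
by rewrite mulr0 addr0 -lE l_le_g.
Qed.

(** The two lower bounds are averaged. *)
Let growsD N N' : (forall x, 0 <= N x) -> (forall x, 0 <= N' x) ->
  grows N -> grows N' -> grows (fun x => N x + N' x).
Proof.
move=> N0 N'0 [v [a [e [vX e0 vP]]]] [v' [a' [e' [vX' e'0 vP']]]].
exists (2^-1 *: (v + v')), (2^-1 * (a + a')), (Num.min (e / 2) (e' / 2)).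
split=> [z Sz||x].
- have -> : 2^-1 *: (v + v') - xi z = 2^-1 *: ((v - xi z) + (v' - xi z)).
    rewrite addrACA -opprD scalerBr -(scaler_nat 2 (xi z) : _ = xi z + xi z).
    by rewrite scalerA mulVf ?pnatr_eq0 // scale1r.
  by rewrite memvZ // memvD ?vX ?vX'.
- by rewrite lt_min !divr_gt0.
- set m := Num.min _ _.
  have m1 : m <= e / 2 by rewrite ge_min lexx.
  have m2 : m <= e' / 2 by rewrite ge_min lexx orbT.
  have := ler_wpM2r (N0 x) m1; have := ler_wpM2r (N'0 x) m2.
  have := vP x; have := vP' x; rewrite dotZl dotDl; lra.
Qed.

Let grows_le N N' K : (forall x, N' x <= K * N x) -> (forall x, 0 <= N x) ->
  grows N -> grows N'.
Proof.
move=> NK N0 [v [a [e [vX e0 vP]]]]; exists v, a, (e / (`|K| + 1)).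
have K0 : 0 < `|K| + 1 by rewrite ltr_wpDl.
split => // [|x]; first by rewrite divr_gt0.
apply: le_trans (vP x); rewrite lerD2l mulrAC ler_pdivrMr // -mulrA ler_pM2l //.
apply: (le_trans (NK x)); rewrite mulrC ler_wpM2l // (le_trans (ler_norm K)) //.
by rewrite lerDl.
Qed.

Let grows_sum (I : Type) (s : seq I) (N : I -> V -> R) :
  (forall i x, 0 <= N i x) -> (forall i, grows (N i)) ->
  grows (fun x => \sum_(i <- s) N i x).
Proof.
move=> N0 Ng; elim: s => [|i s IH].
  by apply: (@grows_le (fun=> 0) _ 0) => // x; rewrite big_nil mulr0.
apply: (@grows_le (fun x => N i x + \sum_(j <- s) N j x) _ 1) => [x|x|].
- by rewrite big_cons mul1r.
- by rewrite addr_ge0 // sumr_ge0.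
- by apply: growsD => // x; rewrite sumr_ge0.
Qed.

(** [g] lies above [l y] and [l z], and the larger of two numbers is their mean plus half their
    distance: this is growth along [xi y - xi z]. Such differences span [X]. *)
Let grows_dot u : u \in X -> grows (fun x => `|dot u x|).
Proof.
rewrite -spanX => /mem_vspan[m [b [s [Ss ->]]]].
apply: (@grows_le (fun x => \sum_(i < m) `|b i| * `|dot (s i) x|) _ 1).
- move=> x; rewrite mul1r dot_suml (le_trans (ler_norm_sum _ _ _)) //.
  by apply: ler_sum => i _; rewrite dotZl normrM.
- by move=> x; apply: sumr_ge0 => i _; rewrite mulr_ge0.
apply: grows_sum => [i x|i]; first by rewrite mulr_ge0.
apply: (@grows_le (fun x => `|dot (s i) x|) _ `|b i|) => //.
have [y [z [Sy Sz ->]]] := Ss i.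
pose ay := t y - dot (xi y) y; pose az := t z - dot (xi z) z.
exists (2^-1 *: (xi y + xi z)), (2^-1 * (ay + az - `|ay - az|)), 2^-1.
split=> [w Sw||x].
- have -> : 2^-1 *: (xi y + xi z) - xi w =
      2^-1 *: ((xi y - xi w) + (xi z - xi w)).
    rewrite addrACA -opprD scalerBr -(scaler_nat 2 (xi w) : _ = xi w + xi w).
    by rewrite scalerA mulVf ?pnatr_eq0 // scale1r.
  by rewrite memvZ // memvD ?xiB.
- by rewrite invr_gt0.
- have := l_le_g x Sy; have := l_le_g x Sz; rewrite !lE -/ay -/az.
  rewrite dotZl dotDl dotBl => gz gy.
  have [|] := ger0P (ay - az); have [|] := ger0P (dot (xi y) x - dot (xi z) x); lra.
Qed.

Let g_coercive : grows (fun x => enorm (P x)).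
Proof.
apply: (@grows_le (fun x => \sum_(i < n) `|dot (P (delta_mx ord0 i)) x|) _ 1).
- move=> x; rewrite mul1r (le_trans (enorm_le_sum _)) //; apply: ler_sum => i _.
  by rewrite (proj_adj hP) dotC dot_delta.
- by move=> x; apply: sumr_ge0.
- by apply: grows_sum => // i; exact/grows_dot/(proj_mem hP).
Qed.

(* A point (x, a) of the convex hull of the graph of g has a weight s carried by
   base points in the ball of radius r. Translating only these points by +-h
   moves x by +-s h, and coercivity bounds s from below when a is near F x. *)
Let F_second_diff r : exists K, forall x h,
  enorm (P x) <= r -> enorm (P h) <= r ->
  F (x + h) + F (x - h) <= 2 * F x + K * enorm (P h) ^+ 2.
Proof.
have [y0 Sy0] := S0.
have [v [a [e [vX e0 vP]]]] := g_coercive.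
have [K0 K00 K0P] := c_le r Sy0.
pose B := `|t y0 - dot (xi y0) y0 - a| + enorm (xi y0 - v) * `|r| +
  K0 * (r + enorm (P y0)) ^+ 2 + 1.
have B0 : 0 <= B.
  by rewrite !addr_ge0 // mulr_ge0 ?enorm_ge0 ?sqr_ge0.
have FB x : enorm (P x) <= r -> F x + 1 <= a + dot v x + B.
  move=> xr; have := F_le_g x; have := g_le x Sy0; have := K0P x xr.
  have xy0 : enorm (P (x - y0)) ^+ 2 <= (r + enorm (P y0)) ^+ 2.
    have xy0 : enorm (P (x - y0)) <= r + enorm (P y0).
      by rewrite (projB hP) (le_trans (enormD _ _)) // enormN lerD2r.
    by rewrite ler_sqr ?nnegrE ?enorm_ge0 // (le_trans (enorm_ge0 _) xy0).
  have := ler_wpM2l K00 xy0.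
  have uX : xi y0 - v \in X by rewrite -opprB memvN vX.
  have : dot (xi y0 - v) x <= enorm (xi y0 - v) * `|r|.
    rewrite (dot_proj hP _ uX) (le_trans (dot_le _ _)) // ler_wpM2l ?enorm_ge0 //.
    by rewrite (le_trans xr) ?ler_norm.
  rewrite dotBl lE /B.
  have := ler_norm (t y0 - dot (xi y0) y0 - a); lra.
(* Beyond [rho] the growth term is at least [2 * B], whereas [FB] leaves less than [B] in total near
   [F x]; so at least half of the weight stays inside. *)
pose rho := 2 * B / e.
have [K K_ge0 KP] := g_semiconcave (Num.max rho (2 * `|r|)).
exists (2 * K) => x h xr hr.
(* [s] is the weight over base points in the ball of radius [rho]. The first clause charges
   [e * rho] to the remaining weight; the second records the effect of moving the inner part by [k].
   The range 2 |r| allows for [k := s^-1 *: h] with [s] at least 1/2. *)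
pose Q y b := exists2 s, 0 <= s <= 1 &
  a + dot v y + (1 - s) * (e * rho) <= b /\
  forall k, enorm (P k) <= 2 * `|r| ->
    F (y + s *: k) + F (y - s *: k) <= 2 * b + s * (K * enorm (P k) ^+ 2).
have rho0 : 0 <= rho by rewrite /rho !mulr_ge0 // invr_ge0 ltW.
apply/ler_addgt0Pr => d d0.
pose d' := Num.min (d / 2) 1.
have d'0 : 0 < d' by rewrite lt_min divr_gt0 //= ltr01.
have d'1 : d' <= 1 by rewrite ge_min lexx orbT.
have d'd : d' <= d / 2 by rewrite ge_min lexx.
have [] := @conv_env_hull _ _ g Q (fun y => a + dot v y) x (F x + d').
- move=> y; have [yr|yr] := leP (enorm (P y)) rho.
    exists 1; first by rewrite ler01 lexx.
    split=> [|k kr].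
      rewrite subrr mul0r addr0; apply: le_trans (vP y).
      by rewrite lerDl mulr_ge0 ?enorm_ge0 // ltW.
    rewrite scale1r mul1r.
    have := KP y k; rewrite !le_max yr kr orbT => /(_ isT isT).
    have := F_le_g (y + k); have := F_le_g (y - k); lra.
  exists 0; first by rewrite ler01 lexx.
  split=> [|k kr].
    rewrite subr0 mul1r; apply: le_trans (vP y).
    by rewrite lerD2l ler_pM2l // ltW.
  rewrite scale0r subr0 addr0 mul0r; have := F_le_g y; lra.
- move=> y b [s /andP[s0 s1] [sb _]]; apply: le_trans sb.
  by rewrite lerDl mulr_ge0 ?subr_ge0 // mulr_ge0 // ltW.
- move=> w y z b b' w01 [s s01 [sb sF]] [s' s'01 [sb' sF']].
  have [w0 w1] := andP w01; have w2 : 0 <= 1 - w by rewrite subr_ge0.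
  have [s0 s1] := andP s01; have [s'0 s'1] := andP s'01.
  exists (w * s + (1 - w) * s').
    apply/andP; split; first by rewrite addr_ge0 ?mulr_ge0.
    by have := ler_wpM2l w0 s1; have := ler_wpM2l w2 s'1; lra.
  split=> [|k kr].
    have := ler_wpM2l w0 sb; have := ler_wpM2l w2 sb'.
    rewrite dotDr !dotZr; lra.
  have cF1 := (convex_funP F).1 F_convex w (y + s *: k) (z + s' *: k) w01.
  have cF2 := (convex_funP F).1 F_convex w (y - s *: k) (z - s' *: k) w01.
  have -> : w *: y + (1 - w) *: z + (w * s + (1 - w) * s') *: k =
      w *: (y + s *: k) + (1 - w) *: (z + s' *: k).
    by rewrite !scalerDr !scalerA (scalerDl k) addrACA.
  have -> : w *: y + (1 - w) *: z - (w * s + (1 - w) * s') *: k =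
      w *: (y - s *: k) + (1 - w) *: (z - s' *: k).
    by rewrite !scalerDr !scalerN !scalerA (scalerDl k) opprD addrACA.
  have := ler_wpM2l w0 (sF k kr); have := ler_wpM2l w2 (sF' k kr); lra.
- by rewrite ltrDl.
move=> b [s /andP[s0 s1] [sb sF]] bF.
have s2 : 1 / 2 <= s.
  have erho : e * rho = 2 * B by rewrite /rho mulrC divfK ?gt_eqF.
  have := FB x xr; rewrite erho in sb => FBx.
  have sB : (1 - s) * 2 * B <= 1 * B - (1 - d') by lra.
  have : 0 < B by rewrite /B ltr_wpDl // !addr_ge0 // mulr_ge0 ?enorm_ge0 ?sqr_ge0.
  move=> Bp; have : (1 - s) * 2 * B <= 1 * B by lra.
  by rewrite ler_pM2r //; lra.
have s_gt0 : 0 < s by apply: lt_le_trans s2; rewrite divr_gt0.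
have si : s^-1 <= 2 by rewrite -div1r ler_pdivrMr //; lra.
have Pk : enorm (P (s^-1 *: h)) = s^-1 * enorm (P h).
  by rewrite (projZ hP) enormZ ger0_norm // invr_ge0 ltW.
have kr : enorm (P (s^-1 *: h)) <= 2 * `|r|.
  rewrite Pk ler_pM ?invr_ge0 ?enorm_ge0 ?(ltW s_gt0) //.
  by rewrite (le_trans hr) ?ler_norm.
(* The displacement is now exactly [h]. The factor s * (s^-1)^2 = s^-1 is at most 2, whence the
   constant [2 * K]. *)
have := sF _ kr; rewrite scalerA divff ?gt_eqF // scale1r Pk.
have -> : s * (K * (s^-1 * enorm (P h)) ^+ 2) = s^-1 * (K * enorm (P h) ^+ 2).
  by field; rewrite gt_eqF.
have : s^-1 * (K * enorm (P h) ^+ 2) <= 2 * (K * enorm (P h) ^+ 2).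
  by rewrite ler_wpM2r // mulr_ge0 ?sqr_ge0.
lra.
Qed.

Let F_C11loc : C11loc F.
Proof.
apply: C11loc_second_diff => // r; have [K KP] := F_second_diff r.
exists `|K| => x h xr hr.
have Px := le_trans (enorm_proj hP x) xr.
have Ph := le_trans (enorm_proj hP h) hr.
apply: (le_trans (KP x h Px Ph)); rewrite lerD2l.
apply: (@le_trans _ _ (`|K| * enorm (P h) ^+ 2)).
  by rewrite ler_wpM2r ?sqr_ge0 ?ler_norm.
by rewrite ler_wpM2l // ler_sqr ?nnegrE ?enorm_ge0 // (enorm_proj hP).
Qed.

(* Along directions orthogonal to X, F stays within a bounded distance of l z. *)
Let subdiff_mem x u z : S z -> subdiff F x u -> u - xi z \in X.
Proof.
move=> Sz Fu; apply: (orthogonal_mem hP) => h Ph0.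
have [K K0 KP] := c_le (enorm (P x)) Sz.
pose C := `|l z x + K * enorm (P (x - z)) ^+ 2 - F x|.
have uC s : s * dot (u - xi z) h <= C.
  have Pxs y : P (y + s *: h) = P y by rewrite (projD hP) (projZ hP) Ph0 scaler0 addr0.
  have := Fu (x + s *: h); rewrite addrAC subrr add0r dotZr.
  have := F_le_g (x + s *: h); have := g_le (x + s *: h) Sz.
  have := KP (x + s *: h); rewrite addrAC !Pxs lexx => /(_ isT).
  rewrite lE dotDr dotZr dotBl.
  have := ler_norm (l z x + K * enorm (P (x - z)) ^+ 2 - F x); rewrite -/C lE.
  lra.
apply/eqP; apply/negPn/negP => d0.
have := uC ((C + 1) / dot (u - xi z) h); rewrite divfK //; lra.
Qed.

(** Each [l y] touches [F] from below at [y], so [xi y] is a subgradient there and, by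
    differentiability, the gradient. Hence the span of the subgradient differences contains [X];
    [subdiff_mem] gives the converse inclusion. *)
Lemma conv_env_extension : is_extension S X t xi (conv_env (fun x =>
  inf [set t y + dot (xi y) (x - y) + c y x | y in S])).
Proof.
have sub y : S y -> subdiff F y (xi y).
  by move=> Sy x; rewrite F_eq //; exact: l_le_F.
split; rewrite -/F => //.
  by move=> y Sy; apply/esym/subdiff_grad; [case: F_C11loc|exact: sub].
apply/eqP; rewrite eqEsubv; apply/andP; split.
  apply: vspan_sub => _ [x [y [u [w [Fu Fw ->]]]]]; have [z Sz] := S0.
  exact: memv_sub_via (subdiff_mem Sz Fu) (subdiff_mem Sz Fw).
rewrite -spanX; apply: vspan_mono => _ [y [z [Sy Sz ->]]].
by exists y, z, (xi y), (xi z); split => //; exact: sub.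
Qed.

End Envelope.

(** * Admissible jets *)

Section Formulas.
Context {R : realType} {n : nat}.
Local Notation V := 'rV[R]_n.
Variables (X : {vspace V}) (P : V -> V) (hP : is_orthoproj X P).
Implicit Types (S : set V) (t : V -> R) (xi : V -> V) (A : nat -> R).
Implicit Types (u v x y z h p q : V) (r : R).

Lemma first_index_gt0 y : (0 < first_index P y)%N.
Proof. by rewrite /first_index; case: ex_minnP => k /andP[]. Qed.

Lemma enorm_le_first_index y : enorm (P y) <= (first_index P y)%:R.
Proof. by rewrite /first_index; case: ex_minnP => k /andP[]. Qed.

Lemma first_index_le y k : (0 < k)%N -> enorm (P y) <= k%:R ->
  (first_index P y <= k)%N.
Proof.
move=> k0 yk; rewrite /first_index; case: ex_minnP => m _; apply.
by rewrite k0.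
Qed.

Lemma enorm_proj_second_diff x y h :
  enorm (P (x + h - y)) ^+ 2 + enorm (P (x - h - y)) ^+ 2 =
  2 * enorm (P (x - y)) ^+ 2 + 2 * enorm (P h) ^+ 2.
Proof.
rewrite (addrAC x h) (addrAC x (- h)).
by rewrite (projD hP (x - y) h) (projB hP (x - y) h) enorm_parallelogram.
Qed.

Lemma prefix_bound A N : exists2 K, 0 <= K & forall k, (k <= N)%N -> A k <= K.
Proof.
exists (\sum_(i < N.+1) `|A i|); first exact: sumr_ge0.
move=> k kN; rewrite (bigD1 (Ordinal (kN : (k < N.+1)%N))) //=.
by rewrite (le_trans (ler_norm (A k))) // lerDl sumr_ge0.
Qed.

Lemma first_index_bound r : exists N, forall y, enorm (P y) <= r ->
  (first_index P y <= N)%N.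
Proof.
exists (Num.truncn r).+1 => y yr; apply: first_index_le => //.
by rewrite (le_trans yr) // ltW // truncnS_gt.
Qed.

(** The parallelogram law computes the second difference exactly, and points [y] in a ball involve
    only finitely many values of [A]. *)
Lemma quadratic_semiconcave (C : V -> R) A : (forall y, C y = A (first_index P y)) ->
  forall r, exists2 K, 0 <= K & forall y x h, enorm (P y) <= r ->
    1 / 2 * C y * enorm (P (x + h - y)) ^+ 2 +
    1 / 2 * C y * enorm (P (x - h - y)) ^+ 2 <=
    2 * (1 / 2 * C y * enorm (P (x - y)) ^+ 2) + K * enorm (P h) ^+ 2.
Proof.
move=> CA r; have [N NP] := first_index_bound r.
have [K K0 KP] := prefix_bound A N; exists K => // y x h /NP/KP.
rewrite -CA => CK; rewrite -mulrDr enorm_proj_second_diff.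
by have := ler_wpM2r (sqr_ge0 (enorm (P h))) CK; lra.
Qed.

Lemma admissible_sub S t xi A y z : admissible X P S t xi A -> S y -> S z ->
  xi y - xi z \in X.
Proof.
by move=> [_ spanX _] Sy Sz; rewrite -spanX; apply: vspan_incl; exists y, z.
Qed.

(** When |P x| <= 4k, admissibility suffices and the summand 1 of the coefficient provides the
    slack. Farther out, the affine function of [z] is below that of [y] at the point [y] and gains
    at most 2M |P(x - y)|; since |P(x - y)| >= 1 there, the summand [4 * M] absorbs this gain. *)
Lemma conv_formula_extension S t xi A (M : R) : S !=set0 ->
  admissible X P S t xi A -> (forall y, S y -> enorm (xi y) <= M) ->
  is_extension S X t xi (conv_formula P S t xi A M).
Proof.
move=> S0 adm xiM; have [A2 spanX AP] := adm.
have M0 : 0 <= M by have [y /xiM] := S0; exact/le_trans/enorm_ge0.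
pose C y := A (first_index P y) + 4 * M + 1.
apply: (@conv_env_extension _ _ X P hP S t xi
  (fun y x => 1 / 2 * C y * enorm (P (x - y)) ^+ 2)) => //.
- by move=> y _; rewrite subrr (proj0 hP) enorm0 expr0n mulr0.
- move=> y z x Sy Sz; set k := first_index P y.
  have k0 := first_index_gt0 y; have yk := enorm_le_first_index y.
  have := sqr_ge0 (enorm (P (x - y))) => xy2.
  have Mxy : 0 <= M * enorm (P (x - y)) ^+ 2 by rewrite mulr_ge0.
  have [xk|xk] := leP (enorm (P x)) (4 * k)%:R.
    by have := AP k z y x k0 Sz (conj Sy yk) xk; rewrite /C -/k; lra.
  have yk' : enorm (P y) <= (4 * k)%:R.
    by rewrite (le_trans yk) // ler_nat leq_pmull.
  have := AP k z y y k0 Sz (conj Sy yk) yk'.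
  rewrite subrr (proj0 hP) enorm0 dot0r expr0n mulr0 !addr0 => lzy.
  have zx : dot (xi z) (x - z) = dot (xi z) (y - z) + dot (xi z) (x - y).
    by rewrite -dotDr (addrC (y - z)) subrKA.
  have : dot (xi z - xi y) (x - y) <= 2 * M * enorm (P (x - y)).
    rewrite (dot_proj hP _ (admissible_sub adm Sz Sy)) (le_trans (dot_le _ _)) //.
    rewrite ler_wpM2r ?enorm_ge0 // (le_trans (enormD _ _)) // enormN.
    by have := xiM _ Sy; have := xiM _ Sz; lra.
  have xy1 : 1 <= enorm (P (x - y)).
    have : enorm (P x) <= enorm (P (x - y)) + enorm (P y).
      by rewrite -[P x](subrK (P y)) -(projB hP) enormD.
    have k1 : 1 <= k%:R :> R by rewrite ler1n.
    by move: xk; rewrite natrM; lra.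
  have : M * enorm (P (x - y)) <= M * enorm (P (x - y)) ^+ 2.
    by rewrite expr2 ler_wpM2l // ler_peMl // enorm_ge0.
  have Ak : 0 <= A k * enorm (P (x - y)) ^+ 2.
    by rewrite mulr_ge0 // (le_trans _ (A2 k k0)).
  rewrite dotBl zx /C -/k; lra.
- move=> r; have [|K _ KP] :=
    @quadratic_semiconcave C (fun k => A k + 4 * M + 1) _ r; first by [].
  by exists K => y x h _ yr _ _; exact: KP.
Qed.

Lemma admissible_le S t xi A A' : (forall k, (0 < k)%N -> A k <= A' k) ->
  admissible X P S t xi A -> admissible X P S t xi A'.
Proof.
move=> AA' [A2 spanX AP]; split => // [k k0|k z y x k0 Sz Sy Px].
  exact: le_trans (A2 k k0) (AA' k k0).
rewrite (le_trans (AP k z y x k0 Sz Sy Px)) // lerD2l.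
by rewrite ler_wpM2r ?sqr_ge0 // ler_pM2r ?AA' // invr_gt0.
Qed.

(** Distance from [p] to the ball of radius [r] about the origin, for [0 <= r]. *)
Definition excess r p : R := Num.max (enorm p - r) 0.

Lemma excess_proj r p : 0 <= r ->
  exists2 q, enorm q <= r & enorm (p - q) = excess r p.
Proof.
move=> r0; rewrite /excess; have [pr|pr] := leP (enorm p - r) 0.
  by exists p; [rewrite -subr_le0|rewrite subrr enorm0].
have p0 : 0 < enorm p by lra.
exists ((r / enorm p) *: p).
  by rewrite enormZ ger0_norm ?divfK ?gt_eqF // divr_ge0 // ltW.
rewrite -{1}[p]scale1r -scalerBl enormZ ger0_norm.
  by rewrite mulrBl mul1r divfK ?gt_eqF.
by rewrite subr_ge0 ler_pdivrMr // mul1r; lra.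
Qed.

(** The distance to a fixed point of the ball bounds [excess r] from above, with equality at [p] for
    the nearest point; the parallelogram law handles the square of that distance. *)
Lemma excess_second_diff r p h : 0 <= r ->
  excess r (p + h) ^+ 2 + excess r (p - h) ^+ 2 <=
  2 * excess r p ^+ 2 + 2 * enorm h ^+ 2.
Proof.
move=> r0; have [q qr <-] := excess_proj p r0; rewrite -enorm_parallelogram.
have ex w : excess r (p + w) ^+ 2 <= enorm (p - q + w) ^+ 2.
  have ew : excess r (p + w) <= enorm (p - q + w).
    rewrite /excess ge_max enorm_ge0 andbT lerBlDr.
    rewrite (le_trans _ (lerD (lexx _) qr)) //.
    by rewrite (le_trans _ (enormD _ _)) // addrAC subrK.
  by rewrite ler_sqr ?nnegrE ?enorm_ge0 // /excess le_max lexx orbT.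
by rewrite lerD ?ex.
Qed.

(* Growth of the base functions when xi is unbounded: it vanishes where
   [enorm (P x) <= 2 * k] and makes up for the growth of A at infinity. *)
Definition tail_growth A k x : R := \sum_(0 <= j < first_index P x)
  if (k <= j)%N then 8 * A j.+1 * excess (2 * j)%:R (P x) ^+ 2 else 0.

(** Terms with [j] at least [first_index P x] vanish, so values at several points can be compared
    over one common range. *)
Lemma tail_growthE A k x N : (first_index P x <= N)%N ->
  tail_growth A k x = \sum_(0 <= j < N)
    if (k <= j)%N then 8 * A j.+1 * excess (2 * j)%:R (P x) ^+ 2 else 0.
Proof.
move=> xN; rewrite (big_cat_nat _ xN) //= [X in _ + X]big1_seq ?addr0 // => j.
rewrite mem_index_iota => /andP[_ /andP[xj _]].
have -> : excess (2 * j)%:R (P x) = 0.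
  apply/max_idPr; rewrite subr_le0 (le_trans (enorm_le_first_index x)) // ler_nat.
  by rewrite (leq_trans xj) // leq_pmull.
by rewrite expr0n mulr0 if_same.
Qed.

Lemma tail_growth_semiconcave A : (forall k, (0 < k)%N -> 2 <= A k) ->
  forall r, exists K, forall k x h, enorm (P x) <= r -> enorm (P h) <= r ->
  tail_growth A k (x + h) + tail_growth A k (x - h) <=
  2 * tail_growth A k x + K * enorm (P h) ^+ 2.
Proof.
move=> A2 r; have [N NP] := first_index_bound (2 * `|r|).
(* 16 is 8 times the 2 of [excess_second_diff]. Omitting the terms with [j < k] only helps, so one
   constant serves every [k]. *)
exists (\sum_(0 <= j < N) 16 * A j.+1) => k x h xr hr.
have rr : r <= `|r| := ler_norm r; have r0 := normr_ge0 r.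
have xh : enorm (P (x + h)) <= 2 * `|r|.
  by rewrite (projD hP) (le_trans (enormD _ _)) //; lra.
have xh' : enorm (P (x - h)) <= 2 * `|r|.
  by rewrite (projB hP) (le_trans (enormD _ _)) // enormN; lra.
have x2 : enorm (P x) <= 2 * `|r| by lra.
rewrite (tail_growthE _ _ (NP _ xh)) (tail_growthE _ _ (NP _ xh')).
rewrite (tail_growthE _ _ (NP _ x2)) -big_split mulr_sumr mulr_suml -big_split.
apply: ler_sum => j _ /=; have Aj : 0 <= A j.+1 := le_trans (ler0n R 2) (A2 j.+1 isT).
case: ifP => kj; last by rewrite addr0 mulr0 add0r mulr_ge0 ?sqr_ge0 // mulr_ge0.
have := @excess_second_diff (2 * j)%:R (P x) (P h) (ler0n _ _).
rewrite -(projD hP) -(projB hP) => ex.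
by have := ler_wpM2l Aj ex; lra.
Qed.

Lemma tail_growth_ge0 A k x : (forall k, (0 < k)%N -> 2 <= A k) ->
  0 <= tail_growth A k x.
Proof.
move=> A2; apply: sumr_ge0 => j _; case: ifP => // _.
by rewrite mulr_ge0 ?sqr_ge0 // mulr_ge0 // (le_trans (ler0n R 2) (A2 j.+1 isT)).
Qed.

Lemma tail_growth_ge A k x j : (forall k, (0 < k)%N -> 2 <= A k) ->
  (k <= j)%N -> 8 * A j.+1 * excess (2 * j)%:R (P x) ^+ 2 <= tail_growth A k x.
Proof.
move=> A2 kj; rewrite (tail_growthE _ _ (leq_addr j.+1 _)).
rewrite (bigD1_seq j) ?iota_uniq //=; last first.
  by rewrite mem_index_iota /= ltn_addl.
rewrite kj lerDl; apply: sumr_ge0 => i _; case: ifP => // _.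
by rewrite mulr_ge0 ?sqr_ge0 // mulr_ge0 // (le_trans (ler0n R 2) (A2 i.+1 isT)).
Qed.

(** With [xi] possibly unbounded, points [x] outside the ball of radius 4k are treated by
    admissibility at a larger index, whose quadratic term is absorbed by [tail_growth]. *)
Lemma admissible_extension S t xi A : S !=set0 -> admissible X P S t xi A ->
  exists F, is_extension S X t xi F.
Proof.
move=> S0 adm; have [A2 spanX AP] := adm.
pose C y := A (first_index P y) + 1.
eexists; apply: (@conv_env_extension _ _ X P hP S t xi
  (fun y x => 1 / 2 * C y * enorm (P (x - y)) ^+ 2 +
    tail_growth A (first_index P y) x)) => //.
- move=> y _; rewrite subrr (proj0 hP) enorm0 expr0n mulr0 add0r.
  rewrite /tail_growth big1_seq // => j; rewrite mem_index_iota => /andP[_ /andP[_ jy]].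
  by rewrite leqNgt jy.
- move=> y z x Sy Sz; set k := first_index P y.
  have k0 := first_index_gt0 y; have yk := enorm_le_first_index y.
  have tg := tail_growth_ge0 k x A2.
  have [xk|xk] := leP (enorm (P x)) (4 * k)%:R.
    by have := AP k z y x k0 Sz (conj Sy yk) xk; rewrite /C -/k; lra.
  (* Here 4j <= |P x| < 4(j + 1), so the excess over 2j is at least |P x| / 2. As |P(x - y)| <= 2 |P
     x|, half of A_(j+1) |P(x - y)|^2 is at most 8 A_(j+1) times the squared excess. *)
  pose j := Num.truncn (enorm (P x) / 4).
  have /andP[jx xj] := truncn_itv (divr_ge0 (enorm_ge0 (P x)) (ler0n R 4)).
  rewrite -/j in jx xj; rewrite natrM in xk.
  have kj : (k <= j)%N.
    by rewrite -ltnS -(ltr_nat R); apply: lt_trans xj; rewrite ltr_pdivlMr //; lra.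
  have kj' : k%:R <= j%:R :> R by rewrite ler_nat.
  have yj : enorm (P y) <= j.+1%:R.
    by rewrite (le_trans yk) // ler_nat (leq_trans kj).
  have xj4 : enorm (P x) <= (4 * j.+1)%:R.
    by rewrite natrM mulrC -ler_pdivrMr // ltW.
  have := AP j.+1 z y x isT Sz (conj Sy yj) xj4.
  have := tail_growth_ge x A2 kj.
  have Aj : 0 <= A j.+1 := le_trans (ler0n R 2) (A2 j.+1 isT).
  have ex : 1 / 2 * enorm (P x) <= excess (2 * j)%:R (P x).
    by rewrite /excess le_max natrM; apply/orP; left; lra.
  have ex2 : (1 / 2 * enorm (P x)) ^+ 2 <= excess (2 * j)%:R (P x) ^+ 2.
    have x0 := enorm_ge0 (P x).
    by rewrite ler_sqr ?nnegrE ?(le_trans _ ex) // mulr_ge0.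
  have xy : enorm (P (x - y)) <= 2 * enorm (P x).
    rewrite (projB hP) (le_trans (enormD _ _)) // enormN.
    by have := enorm_ge0 (P y); lra.
  have xy2 : enorm (P (x - y)) ^+ 2 <= (2 * enorm (P x)) ^+ 2.
    by rewrite ler_sqr ?nnegrE ?enorm_ge0 // mulr_ge0 ?enorm_ge0.
  have := ler_wpM2l Aj xy2; have := ler_wpM2l Aj ex2.
  have : 0 <= A k * enorm (P (x - y)) ^+ 2.
    by rewrite mulr_ge0 ?sqr_ge0 // (le_trans _ (A2 k k0)).
  rewrite /C -/k; have := sqr_ge0 (enorm (P (x - y))); lra.
- move=> r; have [|K K0 KP] :=
    @quadratic_semiconcave C (fun k => A k + 1) _ r; first by [].
  have [L LP] := tail_growth_semiconcave A2 r.
  exists (K + L) => y x h _ yr xr hr.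
  by have := KP y x h yr; have := LP (first_index P y) x h xr hr; lra.
Qed.

End Formulas.

(** * Jets of an extension *)

Section Necessity.
Context {R : realType} {n : nat}.
Local Notation V := 'rV[R]_n.
Variables (X : {vspace V}) (F : V -> R).
Hypothesis F_convex : convex_fun F.
Hypothesis F_C11 : C11loc F.
Hypothesis spanF : subdiff_span F = X.
Implicit Types (S E : set V) (x y z p : V).

Lemma differences_congr S (xi xi' : V -> V) : (forall y, S y -> xi y = xi' y) ->
  differences xi S = differences xi' S.
Proof.
move=> xiE; apply/seteqP; split => _ [y [z [Sy Sz ->]]]; exists y, z.
  by rewrite !xiE.
by rewrite -!xiE.
Qed.

Lemma grad_subdiffF x y : F x + dot (grad F x) (y - x) <= F y.
Proof. by apply: grad_subdiff => //; case: F_C11. Qed.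

Lemma gradB_mem x y : grad F x - grad F y \in X.
Proof.
rewrite -spanF; apply: vspan_incl; exists x, y, (grad F x), (grad F y).
by split => // z; exact: grad_subdiffF.
Qed.

(** [x - P x] is orthogonal to every gradient difference, so the tangent inequalities make
    [grad F (P x)] a subgradient at [x]. *)
Lemma grad_proj (P : V -> V) x : is_orthoproj X P -> grad F (P x) = grad F x.
Proof.
move=> hP; apply: subdiff_grad => [|y]; first by case: F_C11.
have xP : dot (grad F x - grad F (P x)) (x - P x) = 0.
  by rewrite dotC; apply: (hP x).2; exact: gradB_mem.
have := grad_subdiffF x (P x); have := grad_subdiffF (P x) y.
move: (grad F x) (grad F (P x)) xP => u w; rewrite dotBl => xP Py Px.
have xPx : dot u (P x - x) = - dot u (x - P x) by rewrite -dotNr opprB.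
rewrite xPx in Px; have -> : y - x = (y - P x) - (x - P x) by rewrite opprB addrA subrK.
by rewrite dotBr; lra.
Qed.

(** By convexity, the tangent at [z] is below F x, which is at most F y + <grad F x, x - y>.
    Replacing [grad F x] by [grad F y] costs L_k |P(x - y)|^2; the Lipschitz bound is taken at [P x]
    and [P y], because the preimage of a ball need not be bounded. *)
Lemma jet_admissible (P : V -> V) S : is_orthoproj X P ->
  vspan (differences (grad F) S) = X -> exists A, admissible X P S F (grad F) A.
Proof.
move=> hP spanS.
have [L LP] := choice (fun k : nat => F_C11.2 0 (4 * k)%:R).
(* The factor 2 offsets the half in A_k / 2; the maximum ensures A_k >= 2. *)
exists (fun k => Num.max 2 (2 * L k)); split => // [k _|k z y x k0 Sz [Sy yk] xk].
  by rewrite le_max lexx.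
have := LP k (P x) (P y); rewrite !subr0 => /(_ xk).
have -> : enorm (P y) <= (4 * k)%:R.
  by rewrite (le_trans yk) // ler_nat leq_pmull.
move=> /(_ isT); rewrite !grad_proj // -(projB hP) => Lxy.
have xy := dot_le (grad F x - grad F y) (P (x - y)).
rewrite -(dot_proj hP _ (gradB_mem x y)) dotBl in xy.
have Lxy2 : enorm (grad F x - grad F y) * enorm (P (x - y)) <=
    L k * enorm (P (x - y)) ^+ 2.
  by rewrite expr2 mulrA ler_wpM2r ?enorm_ge0.
have := grad_subdiffF z x; have := grad_subdiffF x y.
move: (grad F x) (grad F y) (grad F z) xy Lxy2 => u v w.
have -> : dot u (y - x) = - dot u (x - y) by rewrite -dotNr opprB.
move=> xy Lxy2 Fxy Fzx.
have : L k <= Num.max 2 (2 * L k) / 2.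
  by rewrite ler_pdivlMr // mulrC le_max lexx orbT.
by move=> /(ler_wpM2r (sqr_ge0 (enorm (P (x - y))))); lra.
Qed.

(** All differences are generated by those from the base point [y0], and [p] contributes one more of
    these. *)
Lemma vspan_differences_cons E (s : seq V) y0 p : E y0 ->
  vspan (differences (grad F) (E `|` [set` p :: s])) =
  (vspan (differences (grad F) (E `|` [set` s])) + <[grad F p - grad F y0]>)%VS.
Proof.
move=> Ey0; set W := vspan _; set W' := vspan _; set v := _ - _.
apply/eqP; rewrite eqEsubv; apply/andP; split.
  have mem y : (E `|` [set` p :: s]) y -> grad F y - grad F y0 \in (W' + <[v]>)%VS.
    have old : (E `|` [set` s]) y -> grad F y - grad F y0 \in (W' + <[v]>)%VS.
      move=> sy; apply: (subvP (addvSl _ _)); apply: vspan_incl.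
      by exists y, y0; split => //; left.
    move=> [Ey|/=]; first by apply: old; left.
    rewrite inE => /orP[/eqP ->|ys]; last by apply: old; right.
    by apply: (subvP (addvSr _ _)); exact: memv_line.
  apply: vspan_sub => _ [y [z [/mem Sy /mem Sz ->]]].
  exact: memv_sub_via Sy Sz.
rewrite subv_add; apply/andP; split.
  apply: vspan_mono => _ [y [z [Sy Sz ->]]]; exists y, z; split => //.
    by case: Sy => [|/= ys]; [left|right; rewrite /= inE ys orbT].
  by case: Sz => [|/= zs]; [left|right; rewrite /= inE zs orbT].
rewrite -memvE; apply: vspan_incl; exists p, y0; split => //; last by left.
by right; rewrite /= mem_head.
Qed.

(** While the span [W] has dimension below that of [X], some [grad F p - grad F y0] escapes it,
    since otherwise [W] would contain [X]. Such a [p] is new, because the gradients at earlier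
    points stay in [W] relative to [y0], and it raises the dimension by exactly one. *)
Lemma exists_new_points E : E !=set0 ->
  let Y := vspan (differences (grad F) E) in
  forall k, (k <= \dim X - \dim Y)%N -> exists s : seq V,
    [/\ size s = k, uniq s, forall p, p \in s -> ~ E p &
      \dim (vspan (differences (grad F) (E `|` [set` s]))) = (\dim Y + k)%N].
Proof.
move=> [y0 Ey0] Y; elim=> [|k IH] kd.
  exists [::]; split => //; rewrite addn0 /Y; congr (\dim (vspan (differences _ _))).
  by apply/seteqP; split => [y [|]|y]; [|by []|left].
have [s [sk us sE dW]] := IH (ltnW kd).
set W := vspan _ in dW.
have [p pW] : exists p, grad F p - grad F y0 \notin W.
  apply: contrapT => /forallNP noP.
  have allW p : grad F p - grad F y0 \in W by apply: contrapT => /negP /noP.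
  have /dimvS : (X <= W)%VS.
    rewrite -spanF; apply: vspan_sub => _ [x [y [u [w [Fu Fw ->]]]]].
    rewrite (subdiff_grad (F_C11.1 x) Fu) (subdiff_grad (F_C11.1 y) Fw).
    exact: memv_sub_via (allW x) (allW y).
  by rewrite dW leqNgt -ltn_subRL kd.
have notW y : (E `|` [set` s]) y -> y <> p.
  move=> sy yp; move/negP: pW; apply; rewrite -yp; apply: vspan_incl.
  by exists y, y0; split => //; left.
exists (p :: s); split; rewrite /= ?sk //.
- by rewrite us andbT; apply/negP => ps; apply: (notW p) => //; right.
- move=> q; rewrite inE => /orP[/eqP -> Ep|/sE //].
  by apply: (notW p) => //; left.
- rewrite (vspan_differences_cons _ _ Ey0) -/W addnS -dW.
  apply/eqP; rewrite eqn_leq; apply/andP; split.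
    rewrite (leq_trans (dimv_add_leqif _ _)) // dim_vline.
    by case: (_ != 0); rewrite ?addn1 ?addn0.
  rewrite ltn_neqAle dimvS ?addvSl // andbT.
  apply: contra pW => /eqP dE.
  have /eqP -> : (W == W + <[grad F p - grad F y0]>)%VS.
    by rewrite eqEdim addvSl dE leqnn.
  by apply: (subvP (addvSr _ _)); exact: memv_line.
Qed.

End Necessity.

(** * Jets enlarged by finitely many points *)

Section NewPoints.
Context {R : realType} {n : nat}.
Local Notation V := 'rV[R]_n.
Context {m : nat} (E : set V) (p : 'I_m -> V).
Hypothesis new : new_points E p.

Lemma add_values_old (T : Type) (g : V -> T) (b : 'I_m -> T) y :
  E y -> add_values g p b y = g y.
Proof.
by move=> Ey; rewrite /add_values; case: pickP => // j /eqP pj; case: (new.2 j); rewrite pj.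
Qed.

Lemma add_values_new (T : Type) (g : V -> T) (b : 'I_m -> T) j :
  add_values g p b (p j) = b j.
Proof.
rewrite /add_values; case: pickP => [i /eqP /new.1 -> //|/(_ j)].
by rewrite eqxx.
Qed.

Lemma add_valuesE (T : Type) (g h : V -> T) y : (forall y, E y -> g y = h y) ->
  add_points E p y -> add_values g p (h \o p) y = h y.
Proof.
move=> gh [Ey|[j _ <-]]; last exact: add_values_new.
by rewrite add_values_old // gh.
Qed.

Lemma is_extension_old (X : {vspace V}) f G b w F :
  is_extension (add_points E p) X (add_values f p b) (add_values G p w) F ->
  is_extension E X f G F.
Proof.
case=> cF F11 Ff FG XF; split => // y Ey.
  by rewrite Ff ?add_values_old //; left.
by rewrite FG ?add_values_old //; left.
Qed.

End NewPoints.

Lemma admissible_congr (R : realType) (n : nat) (X : {vspace 'rV[R]_n})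
    (P : 'rV[R]_n -> 'rV[R]_n) (S : set 'rV[R]_n) t t' xi xi' A :
  (forall y, S y -> t y = t' y) -> (forall y, S y -> xi y = xi' y) ->
  admissible X P S t xi A -> admissible X P S t' xi' A.
Proof.
move=> tt' xixi' [A2 spanX AP]; split => // [|k z y x k0 Sz Sy xk].
  by rewrite -(differences_congr xixi').
by rewrite -!tt' -?xixi' ?(AP k) //; case: Sy.
Qed.

Lemma enorm_le_supnorm (R : realType) (n : nat) (S : set 'rV[R]_n) xi :
  (exists M, forall y, S y -> enorm (xi y) <= M) ->
  forall y, S y -> enorm (xi y) <= supnorm S xi.
Proof.
move=> [M xiM] y Sy; apply: ub_le_sup; last by exists y.
by exists M => _ [z Sz <-]; exact: xiM.
Qed.

Theorem theorem1p10 (R : realType) (n : nat)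
    (E : set 'rV[R]_n) (hE : E !=set0)
    (X : {vspace 'rV[R]_n})
    (P : 'rV[R]_n -> 'rV[R]_n) (hP : is_orthoproj X P)
    (f : 'rV[R]_n -> R) (G : 'rV[R]_n -> 'rV[R]_n) :
  let Y := vspan (differences G E) in
  let l := \dim Y in
  let d := \dim X in
  ((exists F : 'rV[R]_n -> R, is_extension E X f G F) <->
   [/\ (Y <= X)%VS,
       (l < d)%N ->
         exists (p : 'I_(d - l) -> 'rV[R]_n) (b : 'I_(d - l) -> R)
                (w : 'I_(d - l) -> 'rV[R]_n) (A : nat -> R),
           new_points E p /\
           admissible X P (add_points E p) (add_values f p b)
             (add_values G p w) A &
       l = d -> exists A : nat -> R, admissible X P E f G A]) /\
  ((exists M : R, forall x, E x -> enorm (G x) <= M) ->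
   (Y <= X)%VS ->
   ((l < d)%N ->
      forall (p : 'I_(d - l) -> 'rV[R]_n) (b : 'I_(d - l) -> R)
             (w : 'I_(d - l) -> 'rV[R]_n) (A : nat -> R),
        let Es := add_points E p in
        let t := add_values f p b in
        let xi := add_values G p w in
        new_points E p -> admissible X P Es t xi A ->
        is_extension E X f G (conv_formula P Es t xi A (supnorm Es xi)) /\
        exists A' : nat -> R,
          [/\ forall k, (0 < k)%N -> A k <= A' k,
              admissible X P Es t xi A' &
              is_extension E X f G
                (conv_formula P Es t xi A' (supnorm E G))]) /\
   (l = d -> forall A : nat -> R, admissible X P E f G A ->
      is_extension E X f G (conv_formula P E f G A (supnorm E G)))).
Proof.
move=> Y l d; split; first split.
- move=> [F [cF F11 Ff FG XF]].
  have YE : vspan (differences (grad F) E) = Y by rewrite (differences_congr FG).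
  have YX : (Y <= X)%VS.
    by rewrite -YE; apply: vspan_sub => _ [y [z [_ _ ->]]]; exact: gradB_mem.
  split=> // [ld|dE].
    have := exists_new_points F11 XF hE; rewrite /= YE.
    move=> /(_ _ (leqnn _))[s [sk us sE dW]].
    rewrite -/l -/d in sk dW.
    pose p (i : 'I_(d - l)) := nth 0 s i.
    have new : new_points E p.
      split=> [i j|j]; last by apply: sE; rewrite mem_nth // sk.
      by move=> /eqP; rewrite nth_uniq ?sk // => /eqP /val_inj.
    have sp : E `|` [set` s] = add_points E p.
      congr (_ `|` _); apply/seteqP; split => [q /= qs|_ [i _ <-]]; last first.
        by rewrite /= mem_nth // sk.
      have qd : (index q s < d - l)%N by rewrite -sk index_mem.
      by exists (Ordinal qd) => //=; rewrite /p nth_index.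
    have spanE : vspan (differences (grad F) (add_points E p)) = X.
      apply/eqP; rewrite eqEdim -sp dW -/d subnKC ?(ltnW ld) // leqnn andbT.
      by apply: vspan_sub => _ [y [z [_ _ ->]]]; exact: gradB_mem.
    have [A adm] := jet_admissible cF F11 XF hP spanE.
    exists p, (F \o p), (grad F \o p), A; split => //.
    apply: admissible_congr adm => y Sy; apply/esym/(add_valuesE new) => // z Ez.
      by rewrite Ff.
    by rewrite FG.
  have spanE : vspan (differences (grad F) E) = X.
    by rewrite YE; apply/eqP; rewrite eqEdim YX -/l dE leqnn.
  have [A adm] := jet_admissible cF F11 XF hP spanE.
  by exists A; exact: admissible_congr adm.
- move=> [YX ltd eqd].
  have : (l <= d)%N by exact: dimvS.
  rewrite leq_eqVlt => /orP[/eqP /eqd[A adm]|/ltd[p [b [w [A [new adm]]]]]].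
    exact: (admissible_extension hP hE adm).
  have S0 : add_points E p !=set0 by have [y Ey] := hE; exists y; left.
  have [F FE] := admissible_extension hP S0 adm.
  by exists F; exact: is_extension_old FE.
move=> Gb YX; split=> [ld p b w A Es t xi new adm|dE A adm]; last first.
  by apply: conv_formula_extension => //; exact: enorm_le_supnorm.
have S0 : Es !=set0 by have [y Ey] := hE; exists y; left.
(* Only finitely many vectors [w j] are added to the bounded family [G]. *)
have xib : exists M, forall y, Es y -> enorm (xi y) <= M.
  have [M GM] := Gb; exists (`|M| + \sum_j enorm (w j)) => y [Ey|[j _ <-]].
    rewrite /xi (add_values_old new) // (le_trans (GM y Ey)) // (le_trans (ler_norm M)) //.
    by rewrite lerDl sumr_ge0 // => j _; exact: enorm_ge0.
  rewrite /xi (add_values_new new) (bigD1 j) //= addrCA lerDl addr_ge0 //.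
  by apply: sumr_ge0 => i _; exact: enorm_ge0.
have xiM := enorm_le_supnorm xib.
split; first by apply: (is_extension_old new); exact: conv_formula_extension.
have M0 : 0 <= supnorm Es xi.
  by have [y Sy] := S0; apply: le_trans (xiM y Sy); exact: enorm_ge0.
have N0 : 0 <= supnorm E G.
  have [y Ey] := hE; apply: le_trans (enorm_le_supnorm Gb Ey); exact: enorm_ge0.
have AA' (a : R) : 0 <= a -> forall k, (0 < k)%N -> A k <= A k + 4 * a.
  by move=> a0 k _; rewrite lerDl mulr_ge0.
(* This [A'] together with the supremum over [E] gives the same coefficients as
   [A k + 4 * supnorm E G] together with the supremum over [Es], so the formula already established
   applies. *)
exists (fun k => A k + 4 * supnorm Es xi); split; first exact: AA'.
  by apply: admissible_le adm; exact: AA'.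
have -> : conv_formula P Es t xi (fun k => A k + 4 * supnorm Es xi) (supnorm E G)
  = conv_formula P Es t xi (fun k => A k + 4 * supnorm E G) (supnorm Es xi).
  rewrite /conv_formula; congr conv_env; apply/funext => x; congr inf.
  by apply: eq_imagel => y _; congr (_ + _ / _ * _ * _); ring.
apply: (is_extension_old new); apply: conv_formula_extension => //.
by apply: admissible_le adm; exact: AA'.
Qed.
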